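(* Let $G$ be a matchstick graph with $n\geq 1$ vertices. Then the number of bounded triangular faces of $G$ is at most \[ 2n+1-\sqrt{12n-3}. \]
   Context: A plane graph $G=(V,E)$ is a drawing of a (finite) graph in the plane such that each vertex is a different point of the plane and each edge $uv\in E$ is represented by a simple arc joining $u$ and $v$, in such a way that two arcs only intersect in a common endpoint. A matchstick graph is a plane graph in which each edge is represented by a straight-line segment of unit length. The graph is not assumed to be connected. The faces of a plane graph are the connected components of the complement of the plane graph in the plane; exactly one of them is unbounded. A bounded face is triangular if it has exactly three boundary vertices (vertices of $G$ on its boundary). *)

(* Defs.v *)
From HB Require Import structures.
From mathcomp Require Import all_boot all_order all_algebra finmap.
From mathcomp Require Import all_classical all_reals all_analysis.

Set Implicit Arguments.
Unset Strict Implicit.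
Unset Printing Implicit Defensive.

Import Order.TTheory GRing.Theory Num.Theory.
Import numFieldNormedType.Exports.

Local Open Scope classical_set_scope.
Local Open Scope ring_scope.

(* The canonical norm of [R * R] is the max norm, whence an explicit Euclidean
   distance; the max norm is used below only through the topology and the
   bounded sets, which are the Euclidean ones. *)
Definition euclid_dist (R : realType) (a b : R * R) : R :=
  Num.sqrt ((a.1 - b.1) ^+ 2 + (a.2 - b.2) ^+ 2).

Definition segment (R : realType) (a b : R * R) : set (R * R) :=
  [set ((1 - t) * a.1 + t * b.1, (1 - t) * a.2 + t * b.2) | t in `[0, 1]].

Definition simple_arc (R : realType) (a b : R * R) (A : set (R * R)) : Prop :=
  exists f : R -> R * R,
    [/\ {within `[0, 1], continuous f}, {in `[0, 1] &, injective f},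
        f 0 = a, f 1 = b & f @` `[0, 1] = A].

Definition frontier (T : topologicalType) (A : set T) : set T :=
  closure A `\` interior A.

(* A finite simple graph drawn in the plane; [edge_arc u v] is meaningful only
   when [adj u v] holds. In [edge_arcs_meet], unordered pairs of vertices are
   compared, so that the condition bears on two different edges. It prevents a
   non-isolated vertex from lying on an arc of which it is not an endpoint;
   isolated vertices are not constrained. *)
Record plane_graph (R : realType) := PlaneGraph {
  vertex : finType;
  adj : rel vertex;
  adj_sym : symmetric adj;
  adj_irrefl : irreflexive adj;
  pos : vertex -> R * R;
  pos_inj : injective pos;
  edge_arc : vertex -> vertex -> set (R * R);
  edge_arc_simple : forall u v, adj u v ->
    simple_arc (pos u) (pos v) (edge_arc u v);
  edge_arc_sym : forall u v, adj u v -> edge_arc u v = edge_arc v u;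
  edge_arcs_meet : forall u v x y z, adj u v -> adj x y ->
    [set u; v]%SET != [set x; y]%SET ->
    edge_arc u v z -> edge_arc x y z ->
    exists w, [/\ w \in [set u; v]%SET, w \in [set x; y]%SET & z = pos w]
}.

Definition matchstick (R : realType) (G : plane_graph R) : Prop :=
  forall u v : vertex G, adj u v ->
    edge_arc u v = segment (pos u) (pos v) /\ euclid_dist (pos u) (pos v) = 1.

Definition drawing (R : realType) (G : plane_graph R) : set (R * R) :=
  range (@pos R G) `|`
  [set z | exists u v : vertex G, adj u v /\ edge_arc u v z].

Definition faces (R : realType) (G : plane_graph R) : set (set (R * R)) :=
  [set connected_component (~` drawing G) z | z in ~` drawing G].

Definition boundary_vertices (R : realType) (G : plane_graph R)
    (F : set (R * R)) : {set vertex G} :=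
  [set v | pos v \in frontier F]%SET.

Definition bounded_triangular_faces (R : realType) (G : plane_graph R) :
    set (set (R * R)) :=
  [set F | [/\ faces G F, bounded_set F & #|boundary_vertices G F| = 3%N]].

(* Main.v *)
Require Import Defs.
From HB Require Import structures.
From mathcomp Require Import all_boot all_order all_algebra.
From mathcomp Require Import ring lra zify.

Set Implicit Arguments.
Unset Strict Implicit.
Unset Printing Implicit Defensive.

Import Order.TTheory GRing.Theory Num.Theory.

Local Open Scope ring_scope.

(** Let n be the number of vertices and t the number of triangles, that is, of
    triples of mutually adjacent vertices. A bounded face with three boundary
    vertices is the interior of such a triangle ([triangular_faces_le]): its
    frontier follows an edge as far as the next vertices on that edge, hence
    lies on the three segments joining the boundary vertices. A half plane that
    misses these segments is connected and unbounded, so it misses the face,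
    which must therefore fill the triangle.

    So it suffices to bound t. Put f = 2n - 2 - t. The claim is that f >= 0 and
    f^2 >= 6t ([triangles_in_bound]); then (f + 3)^2 >= 6t + 6f + 9 = 12n - 3,
    which is the stated inequality, as 2n + 1 - t = f + 3.

    Rotate the drawing so that no two vertices have the same abscissa, and keep
    only the vertices and edges that belong to triangles. The claim is proved by
    peeling off the set B of vertices visible from below, those with no edge
    passing underneath, or else the set B' of vertices visible from above.

    - At most 2|B| - 3 triangles have a vertex in B ([peeled_bound]). Go through B
      by increasing abscissa. Two successive vertices v and w are joined by an
      edge that is lowest at both ends, unless v has no neighbour on its right or
      w has none on its left ([consecutive_visible]). When they are joined, at
      most two triangles lie to the right of v or to the left of w, because the
      two angles between the edge and the upward verticals at v and w add up to
      180 degrees ([consecutive_weight]). Adding up gives the bound; each joining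
      edge saves one, since its triangle is met at both ends.

    - |B| + |B'| + t <= 2n ([lower_upper_bound]). The side of a triangle that joins
      its leftmost and rightmost vertices hides the third vertex from below or
      from above, and no two triangles hide the same vertex from the same side.

    By the second point the smaller of B and B' has at most (f + 2) / 2 vertices.
    Removing it lowers f by at least 3, by the first point, and this is just
    enough to carry f^2 >= 6t through the induction, up to one borderline case
    that is settled modulo 4 ([peel_arith]).

    Unit lengths enter through [sector_empty]: an edge leaving the apex of a
    triangle inside its angle of 60 degrees has the length of the sides, so it
    would cross the third side. *)

(** * Straight drawings in general position *)

(** Twice the signed area of the triangle p q z: positive when z lies to the left
    of the line directed from p to q. *)
Definition cross (R : realFieldType) (p q z : R * R) : R :=
  (q.1 - p.1) * (z.2 - p.2) - (q.2 - p.2) * (z.1 - p.1).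

Section Straight.
Variables (R : realFieldType) (V : finType).

Definition orientation (X Y : V -> R) (p q z : V) : R :=
  cross (X p, Y p) (X q, Y q) (X z, Y z).

(** A matchstick graph, reduced to the coordinates of its vertices and to its edge
    relation, none of whose edges is vertical. The two coordinates are separate
    functions so that a drawing can be reflected by negating one of them. Asking
    that [X] be injective on all vertices, adjacent or not, makes the vertices
    visible from below a linearly ordered sequence. *)
Record straight (X Y : V -> R) (E : rel V) : Prop := Straight {
  straight_sym : symmetric E;
  straight_irr : irreflexive E;
  straight_unit : forall u v, E u v ->
    (X u - X v) ^+ 2 + (Y u - Y v) ^+ 2 = 1;
  straight_meet : forall u v x y s t, E u v -> E x y ->
    [set u; v]%SET != [set x; y]%SET ->
    0 <= s <= 1 -> 0 <= t <= 1 ->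
    (1 - s) * X u + s * X v = (1 - t) * X x + t * X y ->
    (1 - s) * Y u + s * Y v = (1 - t) * Y x + t * Y y ->
    exists w, [/\ w \in [set u; v]%SET, w \in [set x; y]%SET,
                  X w = (1 - s) * X u + s * X v
                & Y w = (1 - s) * Y u + s * Y v];
  straight_inj : injective X }.

Lemma straight_flipY (X Y : V -> R) (E : rel V) :
  straight X Y E -> straight X (fun v => - Y v) E.
Proof.
move=> [sym irr un me inj]; split=> //.
- by move=> u v /un <-; ring.
- move=> u v x y s t Euv Exy ne s01 t01 eX eY.
  have [|w [w1 w2 w3 w4]] := me u v x y s t Euv Exy ne s01 t01 eX.
    by apply: oppr_inj; rewrite !opprD -!mulrN.
  by exists w; split=> //; rewrite w4; ring.
Qed.

Lemma straight_flipX (X Y : V -> R) (E : rel V) :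
  straight X Y E -> straight (fun v => - X v) Y E.
Proof.
move=> [sym irr un me inj]; split=> //.
- by move=> u v /un <-; ring.
- move=> u v x y s t Euv Exy ne s01 t01 eX eY.
  have [||w [w1 w2 w3 w4]] := me u v x y s t Euv Exy ne s01 t01 => //.
    by apply: oppr_inj; rewrite !opprD -!mulrN.
  by exists w; split=> //; rewrite w3; ring.
- by move=> u v /oppr_inj /inj.
Qed.

Lemma straight_subrel (X Y : V -> R) (E E' : rel V) :
  symmetric E' -> subrel E' E -> straight X Y E -> straight X Y E'.
Proof.
move=> sym' sub [sym irr un me inj]; split=> //.
- by move=> u; apply/negP => /sub; rewrite irr.
- by move=> u v /sub /un.
- by move=> u v x y s t /sub Euv /sub Exy; exact: me.
Qed.

(** All cliques of size three, whether or not they bound a face. *)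
Definition triangles (E : rel V) : {set {set V}} :=
  [set S : {set V} | (#|S| == 3%N) &&
     [forall u in S, forall v in S, (u != v) ==> E u v]].

Definition touched (E : rel V) : {set V} := [set v | [exists w, E v w]].

End Straight.

Section Drawing.
Variables (R : realFieldType) (V : finType) (X Y : V -> R) (E : rel V).
Hypothesis H : straight X Y E.
Local Notation orient := (orientation X Y).

Let symE : symmetric E := straight_sym H.

Lemma edge_neq u v : E u v -> u != v.
Proof. by move=> Euv; apply/eqP=> uv; move: Euv; rewrite uv (straight_irr H). Qed.

Lemma X_neq u v : u != v -> X u != X v.
Proof. by apply: contra => /eqP /(straight_inj H) ->. Qed.

(** The angle of an equilateral triangle has cosine 1/2. *)
Lemma unit_dot v a b : E v a -> E v b -> E a b ->
  (X a - X v) * (X b - X v) + (Y a - Y v) * (Y b - Y v) = 1 / 2.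
Proof.
move=> /(straight_unit H) va /(straight_unit H) vb /(straight_unit H) ab.
have -> : 1 / 2 = (1 + 1 - 1) / 2 :> R by field.
have -> : (X a - X v) * (X b - X v) + (Y a - Y v) * (Y b - Y v) =
  (((X v - X a) ^+ 2 + (Y v - Y a) ^+ 2) + ((X v - X b) ^+ 2 + (Y v - Y b) ^+ 2)
   - ((X a - X b) ^+ 2 + (Y a - Y b) ^+ 2)) / 2 by field.
by rewrite va vb ab.
Qed.

Lemma orient_sq v a b : E v a -> E v b -> E a b -> orient v a b ^+ 2 = 3 / 4.
Proof.
move=> Eva Evb Eab; rewrite /orientation /cross /=.
have -> : ((X a - X v) * (Y b - Y v) - (Y a - Y v) * (X b - X v)) ^+ 2 =
  ((X v - X a) ^+ 2 + (Y v - Y a) ^+ 2) * ((X v - X b) ^+ 2 + (Y v - Y b) ^+ 2) -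
  ((X a - X v) * (X b - X v) + (Y a - Y v) * (Y b - Y v)) ^+ 2 by ring.
rewrite (straight_unit H Eva) (straight_unit H Evb) (unit_dot Eva Evb Eab).
by field.
Qed.

Lemma orient_neq0 v a b : E v a -> E v b -> E a b -> orient v a b != 0.
Proof.
move=> Eva Evb Eab; apply/eqP => o; have := orient_sq Eva Evb Eab.
by rewrite o => e; lra.
Qed.

Lemma orient_swap v a b : orient v b a = - orient v a b.
Proof. by rewrite /orientation /cross /=; ring. Qed.

Lemma trianglesP S : S \in triangles E -> forall v, v \in S ->
  exists a b, [/\ S = [set v; a; b]%SET, E v a, E v b, E a b & 0 < orient v a b].
Proof.
rewrite inE => /andP[/eqP S3 /forall_inP cl] v vS.
have {}cl x y : x \in S -> y \in S -> x != y -> E x y.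
  by move=> xS yS; move/forall_inP: (cl _ xS) => /(_ _ yS) /implyP.
have /cards2P[a [b [ab Sab]]] : #|S :\ v| == 2.
  by move: S3; rewrite (cardsD1 v) vS add1n => -[->].
have : a \in S :\ v by rewrite Sab !inE eqxx.
have : b \in S :\ v by rewrite Sab !inE eqxx orbT.
rewrite !inE => /andP[bv bS] /andP[av aS].
have Eab := cl _ _ aS bS ab.
have Eva : E v a by apply: cl; rewrite // eq_sym.
have Evb : E v b by apply: cl; rewrite // eq_sym.
have := orient_neq0 Eva Evb Eab; rewrite neq_lt => /orP[o|o].
- exists b, a; split => //; last by rewrite orient_swap oppr_gt0.
  + by rewrite -(setD1K vS) Sab setUA; apply/setP => z; rewrite !inE -!orbA; congr (_ || _); rewrite orbC.
  + by rewrite symE.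
- exists a, b; split => //.
  by rewrite -(setD1K vS) Sab setUA.
Qed.

(** Write w - v as al (a - v) + be (b - v) with al, be > 0. As all three vectors
    have length 1, al^2 + al be + be^2 = 1, so al + be > 1 and w lies beyond the
    line ab: the edge vw crosses the edge ab, away from their endpoints. *)
Lemma sector_empty v a b w : E v a -> E v b -> E a b -> 0 < orient v a b ->
  E v w -> 0 < orient v a w -> 0 < orient v w b -> False.
Proof.
move=> Eva Evb Eab o Evw oaw owb.
have va := straight_unit H Eva; have vb := straight_unit H Evb.
have ab := straight_unit H Eab; have vw := straight_unit H Evw.
pose al := orient v w b / orient v a b; pose be := orient v a w / orient v a b.
have al0 : 0 < al by rewrite divr_gt0.
have be0 : 0 < be by rewrite divr_gt0.
have o0 : orient v a b != 0 by rewrite gt_eqF.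
have wX : X w - X v = al * (X a - X v) + be * (X b - X v).
  by rewrite /al /be; move: o0; rewrite /orientation /cross /= => o0; field.
have wY : Y w - Y v = al * (Y a - Y v) + be * (Y b - Y v).
  by rewrite /al /be; move: o0; rewrite /orientation /cross /= => o0; field.
have dot := unit_dot Eva Evb Eab.
have sq : al ^+ 2 + be ^+ 2 + al * be = 1.
  have : (X w - X v) ^+ 2 + (Y w - Y v) ^+ 2 = 1 by rewrite -vw; ring.
  rewrite wX wY.
  have -> : (al * (X a - X v) + be * (X b - X v)) ^+ 2 +
      (al * (Y a - Y v) + be * (Y b - Y v)) ^+ 2 =
    al ^+ 2 * ((X v - X a) ^+ 2 + (Y v - Y a) ^+ 2) + be ^+ 2 * ((X v - X b) ^+ 2 + (Y v - Y b) ^+ 2)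
    + 2 * (al * be) * ((X a - X v) * (X b - X v) + (Y a - Y v) * (Y b - Y v)) by ring.
  by rewrite va vb dot; lra.
pose si := al + be.
have si1 : 1 < si.
  have albe : 0 < al * be by rewrite mulr_gt0.
  rewrite ltNge; apply/negP => le1.
  have : si ^+ 2 <= 1 by rewrite -(expr1n R 2) ler_pXn2r // ?nnegrE ?addr_ge0 ?ltW //.
  have -> : si ^+ 2 = al ^+ 2 + be ^+ 2 + al * be + al * be by rewrite /si; ring.
  by rewrite sq; lra.
have si0 : 0 < si by lra.
have sin0 : si != 0 by rewrite gt_eqF.
have ne : [set v; w]%SET != [set a; b]%SET.
  apply/eqP => /setP /(_ v); rewrite !inE eqxx /= => /esym.
  by rewrite (negbTE (edge_neq Eva)) (negbTE (edge_neq Evb)).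
have := @straight_meet _ _ _ _ _ H v w a b (si^-1) (be / si) Evw Eab ne.
case.
- by rewrite invr_ge0 ltW //= invf_le1 // ltW.
- apply/andP; split; first by rewrite divr_ge0 // ltW.
  by rewrite ler_pdivrMr // mul1r /si; lra.
- have -> : X w = X v + (X w - X v) by ring.
  by rewrite wX /si; field.
- have -> : Y w = Y v + (Y w - Y v) by ring.
  by rewrite wY /si; field.
move=> u [+ + _ _]; rewrite !inE => /orP[/eqP->|/eqP->].
  by rewrite (negbTE (edge_neq Eva)) (negbTE (edge_neq Evb)).
move=> /orP[] /eqP e; move: oaw owb; rewrite e /orientation /cross /=; lra.
Qed.

End Drawing.

(** * Triangles at a vertex *)

Section Sectors.
Variables (R : rcfType) (V : finType).

(** Triangles on the left of a vertex are those on its right once [X] is negated. *)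
Definition leftmost_in (X : V -> R) (v : V) (S : {set V}) : bool :=
  (v \in S) && [forall u in S, (u != v) ==> (X v < X u)].

Definition right_triangles (X : V -> R) (E : rel V) (v : V) : {set {set V}} :=
  [set S in triangles E | leftmost_in X v S].

(** The triangles that hide [v] from below: [v] is the middle vertex in order of
    abscissa, and lies above the opposite side. *)
Definition hanging_triangles (X Y : V -> R) (E : rel V) (v : V) : {set {set V}} :=
  [set S in triangles E | (v \in S) && [exists l in S, exists r in S,
     [&& X l < X v, X v < X r & 0 < orientation X Y l r v]]].

Definition sqrt3_2 : R := Num.sqrt 3 / 2.

Lemma sqrt3_2_gt0 : 0 < sqrt3_2.
Proof. by rewrite divr_gt0 // sqrtr_gt0. Qed.

Lemma sqrt3_2_sq : sqrt3_2 ^+ 2 = 3 / 4.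
Proof. by rewrite /sqrt3_2 expr_div_n sqr_sqrtr //; field. Qed.

Variables (X Y : V -> R) (E : rel V).
Hypothesis H : straight X Y E.
Local Notation orient := (orientation X Y).
Local Notation h := sqrt3_2.

(** The abscissas of the vector from [p] to [q] turned counterclockwise by 60 and by
    120 degrees. Their signs locate its direction among multiples of 30 degrees,
    so that angles need not be introduced. *)
Definition turn60_x (p q : V) : R := (X q - X p) / 2 - h * (Y q - Y p).
Definition turn120_x (p q : V) : R := - ((X q - X p) / 2) - h * (Y q - Y p).

Lemma third_vertex v a b : E v a -> E v b -> E a b -> 0 < orient v a b ->
  X b - X v = (X a - X v) / 2 - h * (Y a - Y v) /\
  Y b - Y v = h * (X a - X v) + (Y a - Y v) / 2.
Proof.
move=> Eva Evb Eab o.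
have va : (X a - X v) ^+ 2 + (Y a - Y v) ^+ 2 = 1.
  by rewrite -(straight_unit H Eva); ring.
have vb : (X b - X v) ^+ 2 + (Y b - Y v) ^+ 2 = 1.
  by rewrite -(straight_unit H Evb); ring.
have dot := unit_dot H Eva Evb Eab.
have oh : orient v a b = h.
  apply/eqP; rewrite -(@eqrXn2 _ 2) ?ltW ?sqrt3_2_gt0 // sqrt3_2_sq.
  by rewrite (orient_sq H).
split.
  rewrite -[LHS]mulr1 -[X in _ * X = _]va -oh /orientation /cross /=.
  have -> : (X a - X v) / 2 = (X a - X v) * (1 / 2) by field.
  by rewrite -dot; ring.
rewrite -[LHS]mulr1 -[X in _ * X = _]va -oh /orientation /cross /=.
have -> : (Y a - Y v) / 2 = (Y a - Y v) * (1 / 2) by field.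
by rewrite -dot; ring.
Qed.

(** A direction of the right half plane stays in it after a turn by 60 degrees
    when a higher one does. *)
Lemma turn60_x_mono v a c : X v < X a -> X v < X c -> 0 <= orient v a c ->
  0 < turn60_x v c -> 0 < turn60_x v a.
Proof.
move=> va vc o t.
have c0 : 0 < X c - X v by rewrite subr_gt0.
rewrite -(pmulr_lgt0 _ c0).
have -> : turn60_x v a * (X c - X v) = turn60_x v c * (X a - X v) + h * orient v a c.
  by rewrite /turn60_x /orientation /cross /=; field.
apply: ltr_wpDr; first by rewrite mulr_ge0 // ltW // sqrt3_2_gt0.
by rewrite mulr_gt0 // subr_gt0.
Qed.

Lemma turn120_x_mono v a c : X v < X a -> X v < X c -> 0 <= orient v a c ->
  0 < turn120_x v c -> 0 < turn120_x v a.
Proof.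
move=> va vc o t.
have c0 : 0 < X c - X v by rewrite subr_gt0.
rewrite -(pmulr_lgt0 _ c0).
have -> : turn120_x v a * (X c - X v) = turn120_x v c * (X a - X v) + h * orient v a c.
  by rewrite /turn120_x /orientation /cross /=; field.
apply: ltr_wpDr; first by rewrite mulr_ge0 // ltW // sqrt3_2_gt0.
by rewrite mulr_gt0 // subr_gt0.
Qed.

Lemma same_ray v a b : E v a -> E v b -> orient v a b = 0 ->
  0 < (X a - X v) * (X b - X v) -> a = b.
Proof.
move=> Eva Evb o pos.
have va : (X a - X v) ^+ 2 + (Y a - Y v) ^+ 2 = 1.
  by rewrite -(straight_unit H Eva); ring.
have vb : (X b - X v) ^+ 2 + (Y b - Y v) ^+ 2 = 1.
  by rewrite -(straight_unit H Evb); ring.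
have sq : (X a - X v) ^+ 2 = (X b - X v) ^+ 2.
  rewrite -[LHS]mulr1 -[X in _ * X = _]vb -[RHS]mulr1 -[X in _ = _ * X]va.
  move: o; rewrite /orientation /cross /= => /eqP; rewrite subr_eq0 => /eqP o.
  rewrite !mulrDr -!exprMn o; ring.
apply: (straight_inj H); apply/eqP; rewrite -(inj_eq (addIr (- X v))).
move/eqP: sq; rewrite eqf_sqr => /orP[//|/eqP e].
by move: pos; rewrite e mulNr -expr2 oppr_gt0 ltNge sqr_ge0.
Qed.

(** The positive orientation puts [c] below [d]. *)
Definition right_pair v c d :=
  [/\ E v c, E v d, E c d, 0 < orient v c d & (X v < X c) && (X v < X d)].

Lemma right_trianglesP v S : S \in right_triangles X E v ->
  exists c d, S = [set v; c; d]%SET /\ right_pair v c d.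
Proof.
rewrite inE => /andP[ST /andP[vS /forall_inP rS]].
have [c [d [Sd Evc Evd Ecd o]]] := trianglesP H ST vS.
exists c, d; split => //; split => //; apply/andP; split.
  have := rS c; rewrite Sd !inE eqxx orbT => /(_ isT) /implyP; apply.
  by rewrite eq_sym (edge_neq H).
have := rS d; rewrite Sd !inE eqxx orbT => /(_ isT) /implyP; apply.
by rewrite eq_sym (edge_neq H).
Qed.

Lemma right_pair_turn60 v c d : right_pair v c d -> 0 < turn60_x v c.
Proof.
move=> [Evc Evd Ecd o /andP[vc vd]].
have [e _] := third_vertex Evc Evd Ecd o.
by rewrite /turn60_x -e subr_gt0.
Qed.

(** The upper side is the lower one turned by 60 degrees. *)
Lemma right_pair_turn60_120 v c d : right_pair v c d -> turn60_x v d = turn120_x v c.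
Proof.
move=> [Evc Evd Ecd o /andP[vc vd]].
have [e1 e2] := third_vertex Evc Evd Ecd o.
rewrite /turn60_x /turn120_x e1 e2.
have -> : h * (h * (X c - X v) + (Y c - Y v) / 2) =
          h ^+ 2 * (X c - X v) + h * ((Y c - Y v) / 2) by ring.
by rewrite sqrt3_2_sq; field.
Qed.

(** Turning the upper side by 120 degrees turns the lower one by 180 degrees. *)
Lemma right_pair_turn120_lt0 v c d : right_pair v c d -> turn120_x v d < 0.
Proof.
move=> [Evc Evd Ecd o /andP[vc vd]].
have [e1 e2] := third_vertex Evc Evd Ecd o.
rewrite /turn120_x e1 e2.
have -> : h * (h * (X c - X v) + (Y c - Y v) / 2) =
          h ^+ 2 * (X c - X v) + h * ((Y c - Y v) / 2) by ring.
rewrite sqrt3_2_sq.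
have -> : - (((X c - X v) / 2 - h * (Y c - Y v)) / 2) -
  (3 / 4 * (X c - X v) + h * ((Y c - Y v) / 2)) = - (X c - X v) by field.
by rewrite oppr_lt0 subr_gt0.
Qed.

(** The sectors of two triangles at [v] do not overlap, by [sector_empty]. *)
Lemma right_pair_order v c d c' d' : right_pair v c d -> right_pair v c' d' ->
  [set v; c; d]%SET != [set v; c'; d']%SET ->
  0 <= orient v d c' \/ 0 <= orient v d' c.
Proof.
move=> [Evc Evd Ecd o /andP[vc vd]] [Evc' Evd' Ecd' o' /andP[vc' vd']] ne.
case: (ltgtP (orient v c c') 0) => occ.
- right; rewrite leNgt orient_swap oppr_lt0; apply/negP => o2.
  by apply: (sector_empty H Evc' Evd' Ecd' o' Evc) => //; rewrite orient_swap oppr_gt0.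
- left; rewrite leNgt orient_swap oppr_lt0; apply/negP => o2.
  exact: (sector_empty H Evc Evd Ecd o Evc').
- have cc : c = c' by apply: (@same_ray v) => //; rewrite mulr_gt0 ?subr_gt0.
  subst c'.
  have [e _] := third_vertex Evc Evd Ecd o.
  have [e' _] := third_vertex Evc' Evd' Ecd' o'.
  have dd : d = d'.
    apply: (straight_inj H); apply/eqP; rewrite -(inj_eq (addIr (- X v))).
    by rewrite e e'.
  by rewrite dd eqxx in ne.
Qed.

Lemma right_pair_turn120 v c d c' d' : right_pair v c d -> right_pair v c' d' ->
  0 <= orient v d c' -> 0 < turn120_x v c.
Proof.
move=> p p' o; rewrite -(right_pair_turn60_120 p).
have t' := right_pair_turn60 p'.
case: p => _ _ _ _ /andP[vc vd]; case: p' => _ _ _ _ /andP[vc' vd'].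
exact: (turn60_x_mono vd vc').
Qed.

(** Three triangles in a row would need an angle of 180 degrees in the open right
    half plane. *)
Lemma right_pair_chain v c d c' d' c'' d'' :
  right_pair v c d -> right_pair v c' d' -> right_pair v c'' d'' ->
  0 <= orient v d c' -> 0 <= orient v d' c'' -> False.
Proof.
move=> p p' p'' o o'.
have t' := right_pair_turn120 p' p'' o'.
have tn := right_pair_turn120_lt0 p.
case: p => _ _ _ _ /andP[vc vd]; case: p' => _ _ _ _ /andP[vc' vd'].
by have := turn120_x_mono vd vc' o t'; rewrite ltNge ltW.
Qed.

Lemma right_triangles_le2 v : (#|right_triangles X E v| <= 2)%N.
Proof.
rewrite leqNgt; apply/negP => /card_gt2P[S1 [S2 [S3 [[]]]]].
move=> /right_trianglesP[c1 [d1 [-> p1]]] /right_trianglesP[c2 [d2 [-> p2]]].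
move=> /right_trianglesP[c3 [d3 [-> p3]]] [n12 n23 n31].
have := right_pair_order p1 p2 n12; have := right_pair_order p2 p3 n23.
have := right_pair_order p3 p1 n31.
have := right_pair_chain p1 p2 p3; have := right_pair_chain p1 p3 p2.
have := right_pair_chain p2 p1 p3; have := right_pair_chain p2 p3 p1.
have := right_pair_chain p3 p1 p2; have := right_pair_chain p3 p2 p1.
tauto.
Qed.

(** If [a] is the lowest neighbour on the right, the triangles on the right of [v]
    fit between the edge va and the upward vertical: one of them forces va below
    the direction of 30 degrees, two force it below that of -30 degrees. *)
Lemma right_triangles_turn v a : X v < X a ->
  (forall c, E v c -> X v < X c -> 0 <= orient v a c) ->
  ((0 < #|right_triangles X E v|)%N -> 0 < turn60_x v a) /\
  ((1 < #|right_triangles X E v|)%N -> 0 < turn120_x v a).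
Proof.
move=> va low; split.
  move=> /card_gt0P[S /right_trianglesP[c [d [_ p]]]].
  have t := right_pair_turn60 p; case: p => Evc _ _ _ /andP[vc _].
  exact: (turn60_x_mono va vc (low _ Evc vc) t).
move=> /card_gt1P[S1 [S2 []]].
move=> /right_trianglesP[c1 [d1 [-> p1]]] /right_trianglesP[c2 [d2 [-> p2]]] ne.
have [o|o] := right_pair_order p1 p2 ne.
  have t := right_pair_turn120 p1 p2 o; case: p1 => Evc _ _ _ /andP[vc _].
  exact: (turn120_x_mono va vc (low _ Evc vc) t).
have t := right_pair_turn120 p2 p1 o; case: p2 => Evc _ _ _ /andP[vc _].
exact: (turn120_x_mono va vc (low _ Evc vc) t).
Qed.

Lemma hanging_trianglesP v S : S \in hanging_triangles X Y E v ->
  exists l r, [/\ S = [set v; l; r]%SET, E v l, E v r, E l r & 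
   [/\ X l < X v, X v < X r & 0 < orient v l r]].
Proof.
rewrite inE => /andP[ST /andP[vS]].
move=> /exists_inP[l lS] /exists_inP[r rS] /and3P[lv vr o].
have nlv : l != v by apply: contraTneq lv => ->; rewrite ltxx.
have nrv : r != v by apply: contraTneq vr => ->; rewrite ltxx.
have nlr : l != r by apply: contraTneq (lt_trans lv vr) => ->; rewrite ltxx.
move: (ST); rewrite inE => /andP[/eqP S3 /forall_inP cl].
have {}cl x y : x \in S -> y \in S -> x != y -> E x y.
  by move=> xS yS; move/forall_inP: (cl _ xS) => /(_ _ yS) /implyP.
exists l, r; split; [|apply: cl => //; by rewrite eq_sym..| exact: cl|split => //].
  apply/esym/eqP; rewrite eqEcard; apply/andP; split.
    by apply/subsetP => z; rewrite !inE => /orP[/orP[]|] /eqP ->.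
  rewrite S3 setUC cardsU1 !inE negb_or cards2.
  by rewrite nrv eq_sym nlr eq_sym nlv.
by move: o; rewrite /orientation /cross /=; lra.
Qed.

(** An edge to the left and counterclockwise from vl leaves [v] inside the sector of
    v l r, because this sector contains the downward vertical. *)
Lemma hanging_left_unique v l r l' : E v l -> E v r -> E l r ->
  X l < X v -> X v < X r -> 0 < orient v l r ->
  E v l' -> X l' < X v -> 0 < orient v l l' -> False.
Proof.
move=> Evl Evr Elr lv vr o Evl' lv' oll.
apply: (sector_empty H Evl Evr Elr o Evl') => //.
have l0 : 0 < X v - X l by rewrite subr_gt0.
rewrite -(pmulr_lgt0 _ l0).
have -> : orient v l' r * (X v - X l) =
  (X v - X l') * orient v l r + orient v l l' * (X r - X v).
  by rewrite /orientation /cross /=; ring.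
by rewrite addr_gt0 // mulr_gt0 // subr_gt0.
Qed.

Lemma hanging_triangles_le1 v : (#|hanging_triangles X Y E v| <= 1)%N.
Proof.
apply/card_le1_eqP => S S'.
move=> /hanging_trianglesP[l [r [-> Evl Evr Elr [lv vr o]]]].
move=> /hanging_trianglesP[l' [r' [-> Evl' Evr' Elr' [lv' vr' o']]]].
have ll : l = l'.
  case: (ltgtP (orient v l l') 0) => oll.
  - by case: (@hanging_left_unique v l' r' l) => //; rewrite orient_swap oppr_gt0.
  - by case: (@hanging_left_unique v l r l').
  - by apply: (@same_ray v) => //; rewrite nmulr_rgt0 subr_lt0.
subst l'.
have rr : r = r'.
  case: (ltgtP (orient v r r') 0) => orr.
  - case: (sector_empty H Evl Evr Elr o Evr') => //.
    by rewrite orient_swap oppr_gt0.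
  - by case: (sector_empty H Evl' Evr' Elr' o' Evr).
  - by apply: (@same_ray v) => //; rewrite mulr_gt0 ?subr_gt0.
by rewrite rr.
Qed.

End Sectors.

(** * Vertices visible from below *)

Section Visible.
Variables (R : rcfType) (V : finType).

Definition visible (X Y : V -> R) (E : rel V) (v : V) : bool :=
  [forall p, forall q, [&& E p q, X p < X v & X v < X q] ==> (orientation X Y p q v < 0)].

(** Isolated vertices are excluded: with them, a visible vertex might have no
    neighbour on either side, and the counts below would fail. *)
Definition lower_envelope (X Y : V -> R) (E : rel V) : {set V} :=
  [set v in touched E | visible X Y E v].

Variables (X Y : V -> R) (E : rel V).
Hypothesis H : straight X Y E.
Local Notation orient := (orientation X Y).
Local Notation B := (lower_envelope X Y E).

Let symE : symmetric E := straight_sym H.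

Definition height (p q : V) (x : R) : R :=
  Y p + (x - X p) * ((Y q - Y p) / (X q - X p)).

Lemma orient_height p q z : X p < X q ->
  orient p q z = (X q - X p) * (Y z - height p q (X z)).
Proof.
move=> pq; have : X q - X p != 0 by rewrite gt_eqF // subr_gt0.
by move=> n0; rewrite /height /orientation /cross /=; field.
Qed.

Lemma orient_lt0 p q z : X p < X q -> (orient p q z < 0) = (Y z < height p q (X z)).
Proof.
by move=> pq; rewrite orient_height // pmulr_rlt0 ?subr_gt0 // subr_lt0.
Qed.

Lemma orient_gt0 p q z : X p < X q -> (0 < orient p q z) = (height p q (X z) < Y z).
Proof.
by move=> pq; rewrite orient_height // pmulr_rgt0 ?subr_gt0 // subr_gt0.
Qed.

Lemma height_l p q : height p q (X p) = Y p.
Proof. by rewrite /height subrr mul0r addr0. Qed.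

Lemma ratio01 (a b x : R) : a < x -> x < b -> 0 <= (x - a) / (b - a) <= 1.
Proof.
move=> ax xb; have ab : 0 < b - a by rewrite subr_gt0 (lt_trans ax).
rewrite ler_pdivrMr // mul1r divr_ge0 ?subr_ge0 ?ltW //=; lra.
Qed.

(** Two edges that exchange their vertical order between two abscissas meet strictly
    in between, where neither has an endpoint. *)
Lemma no_crossing v q w r x1 x2 : E v q -> E w r -> X v < X q -> X w < X r ->
  x1 < x2 -> X v <= x1 -> x2 <= X q -> X w <= x1 -> x2 <= X r ->
  height v q x1 < height w r x1 -> height w r x2 < height v q x2 -> False.
Proof.
move=> Evq Ewr vq wr x12 vx1 x2q wx1 x2r h1 h2.
set D1 := height w r x1 - height v q x1.
set D2 := height v q x2 - height w r x2.
have D10 : 0 < D1 by rewrite subr_gt0.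
have D20 : 0 < D2 by rewrite subr_gt0.
have D0 : D1 + D2 != 0 by rewrite gt_eqF // addr_gt0.
(* the abscissa at which the two lines meet *)
pose x := x1 + (x2 - x1) * (D1 / (D1 + D2)).
have x1x : x1 < x.
  by rewrite /x ltrDl mulr_gt0 ?subr_gt0 // divr_gt0 // addr_gt0.
have xx2 : x < x2.
  have -> : x2 = x + (x2 - x1) * (D2 / (D1 + D2)) by rewrite /x; field.
  by rewrite ltrDl mulr_gt0 ?subr_gt0 // divr_gt0 // addr_gt0.
have qv0 : X q - X v != 0 by rewrite gt_eqF // subr_gt0.
have rw0 : X r - X w != 0 by rewrite gt_eqF // subr_gt0.
have hx : height v q x = height w r x.
  apply/eqP; rewrite -subr_eq0; apply/eqP.
  have lin a b : height a b x =
    (D2 * height a b x1 + D1 * height a b x2) / (D1 + D2).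
    rewrite /height /x; move: ((Y b - Y a) / (X b - X a)) => k.
    by move: D1 D2 D0 {D10 D20 x x1x xx2} => D1 D2 D0; field.
  rewrite !lin -mulrBl.
  have -> : D2 * height v q x1 + D1 * height v q x2 -
    (D2 * height w r x1 + D1 * height w r x2) = 0 by rewrite /D1 /D2; ring.
  by rewrite mul0r.
have ne : [set v; q]%SET != [set w; r]%SET.
  apply/eqP => e.
  have vq' : v != q by rewrite (edge_neq H).
  have : v \in [set w; r]%SET by rewrite -e !inE eqxx.
  have : q \in [set w; r]%SET by rewrite -e !inE eqxx orbT.
  rewrite !inE => /orP[]/eqP qe /orP[]/eqP ve.
  - by move: vq'; rewrite ve qe eqxx.
  - by move: vq; rewrite qe ve ltNge ltW.
  - by move: h1; rewrite ve qe ltxx.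
  - by move: vq'; rewrite ve qe eqxx.
have := @straight_meet _ _ _ _ _ H v q w r
  ((x - X v) / (X q - X v)) ((x - X w) / (X r - X w)) Evq Ewr ne.
have vx : X v < x by apply: le_lt_trans x1x.
have wx : X w < x by apply: le_lt_trans x1x.
have xq : x < X q by apply: lt_le_trans x2q.
have xr : x < X r by apply: lt_le_trans x2r.
case.
- exact: ratio01.
- exact: ratio01.
- by field; rewrite qv0 rw0.
- have -> : (1 - (x - X v) / (X q - X v)) * Y v + (x - X v) / (X q - X v) * Y q
    = height v q x by rewrite /height; field.
  by rewrite hx /height; field.
move=> u [+ _ + _]; rewrite !inE => /orP[]/eqP-> ux.
  have : X v = x by rewrite ux; field.
  by move=> e; rewrite e ltxx in vx.
have : X q = x by rewrite ux; field.
by move=> e; rewrite e ltxx in xq.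
Qed.

Lemma vertex_off_edge v q w r : E v q -> E w r -> X v < X w -> X w < X q ->
  orient v q w != 0.
Proof.
move=> Evq Ewr vw wq; have vq := lt_trans vw wq.
rewrite orient_height // mulf_eq0 negb_or gt_eqF ?subr_gt0 //=.
apply/eqP => /eqP; rewrite subr_eq0 => /eqP hw.
have qv0 : X q - X v != 0 by rewrite gt_eqF // subr_gt0.
have wv : w != v by apply: contraTneq vw => ->; rewrite ltxx.
have wq' : w != q by apply: contraTneq wq => ->; rewrite ltxx.
have ne : [set v; q]%SET != [set w; r]%SET.
  apply/eqP => /setP /(_ w); rewrite !inE eqxx /=.
  by rewrite (negbTE wv) (negbTE wq').
have := @straight_meet _ _ _ _ _ H v q w r
  ((X w - X v) / (X q - X v)) 0 Evq Ewr ne.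
case.
- exact: ratio01.
- by rewrite lexx ler01.
- by field.
- by rewrite mul0r addr0 subr0 mul1r hw /height; field.
move=> u [+ _ + _]; rewrite !inE => /orP[]/eqP-> ux.
  have : X v = X w by rewrite ux; field.
  by move=> e; rewrite e ltxx in vw.
have : X q = X w by rewrite ux; field.
by move=> e; rewrite e ltxx in wq.
Qed.

Lemma visibleP v p q : v \in B -> E p q -> X p < X v -> X v < X q ->
  orient p q v < 0.
Proof.
rewrite inE => /andP[_ /forallP /(_ p) /forallP /(_ q) /implyP vis] Epq pv vq.
by apply: vis; rewrite Epq pv.
Qed.

Lemma touchedP v w : E v w -> v \in touched E.
Proof. by move=> Evw; rewrite inE; apply/existsP; exists w. Qed.

Section Lowest.
Variables (v q : V).
Hypotheses (vB : v \in B) (Evq : E v q) (vq : X v < X q).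
Hypothesis low : forall c, E v c -> X v < X c -> 0 <= orient v q c.

(** At the abscissa of [z] the edge wr is strictly below vq. It cannot come from the
    left of [v], since it would hide [v] or cross vq, nor start at [v], where vq is
    lowest. As it does not cross vq, its left end is under vq too. *)
Lemma hidden_edge_starts_below z w r : X v < X z -> X z <= X q -> orient v q z <= 0 ->
  E w r -> X w < X z -> X z <= X r -> 0 <= orient w r z ->
  (orient v q z < 0) || (0 < orient w r z) ->
  X v < X w /\ orient v q w < 0.
Proof.
move=> vz zq oz Ewr wz zr oz' st.
have wr : X w < X r := lt_le_trans wz zr.
have hz : height w r (X z) < height v q (X z).
  move: oz; rewrite le_eqVlt => /orP[/eqP oz|oz]; last first.
    move: oz; rewrite orient_lt0 //; apply: le_lt_trans.
    by rewrite leNgt -orient_lt0 // -leNgt.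
  move: st; rewrite oz ltxx /= orient_gt0 // => /lt_le_trans; apply.
  by rewrite leNgt -orient_gt0 // oz ltxx.
case: (ltgtP (X w) (X v)) => wv.
- exfalso.
  have ov := visibleP vB Ewr wv (lt_le_trans vz zr).
  move: ov; rewrite orient_lt0 // => ov.
  apply: (@no_crossing v q w r (X v) (X z)) => //; first exact: ltW.
  by rewrite height_l.
- split => //; case: (ltgtP (orient v q w) 0) => // ow.
  + exfalso; move: ow; rewrite orient_gt0 // => ow.
    apply: (@no_crossing v q w r (X w) (X z)) => //; first exact: ltW.
    by rewrite height_l.
  + have := vertex_off_edge Evq Ewr wv (lt_le_trans wz zq).
    by rewrite ow eqxx.
- move/(straight_inj H): wv => wv; subst w; exfalso.
  have := low Ewr wr; rewrite /orientation /cross /= subr_ge0 => hr.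
  move: hz; rewrite ltNge => /negP; apply.
  rewrite /height lerD2l ler_pM2l ?subr_gt0 //.
  by rewrite ler_pdivrMr ?subr_gt0 // mulrAC ler_pdivlMr ?subr_gt0 // [leRHS]mulrC.
Qed.

(** A vertex [z] under vq is visible, or is hidden by an edge, whose left end is again
    under vq and further to the left: the search stops at a visible vertex. *)
Lemma visible_before z : z \in touched E -> X v < X z -> X z <= X q ->
  orient v q z <= 0 -> exists2 z', z' \in B & X v < X z' <= X z.
Proof.
have [n] := ubnP #|[set u | X u < X z]|; elim: n => // n IH in z *.
rewrite ltnS => le zt vz zq oz.
have [vis|] := boolP (visible X Y E z).
  by exists z; rewrite ?vz ?lexx // inE zt vis.
rewrite negb_forall => /existsP[w]; rewrite negb_forall => /existsP[r].
rewrite negb_imply -leNgt => /andP[/and3P[Ewr wz zr]].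
rewrite le_eqVlt => /orP[/eqP o0|o].
  have /existsP[z' Ez'] : [exists z', E z z'] by rewrite inE in zt.
  by have := vertex_off_edge Ewr Ez' wz zr; rewrite -o0 eqxx.
have [|vw ow] := @hidden_edge_starts_below z w r vz zq oz Ewr wz (ltW zr) (ltW o).
  by rewrite o orbT.
have [||z' z'B /andP[vz' z'w]] := IH w _ (touchedP Ewr) vw _ (ltW ow).
- apply: leq_trans le; apply: proper_card; apply/properP; split.
    by apply/subsetP => u; rewrite !inE => /lt_trans; apply.
  by exists w; rewrite !inE ?wz ?ltxx.
- by apply: ltW; apply: lt_le_trans zq.
- by exists z' => //; rewrite vz' (le_trans z'w) // ltW.
Qed.

End Lowest.

Lemma lowest_right v c : E v c -> X v < X c ->
  exists q, [/\ E v q, X v < X q &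
   forall c, E v c -> X v < X c -> 0 <= orient v q c].
Proof.
move=> Evc vc.
pose P c := E v c && (X v < X c).
have Pc : P c by rewrite /P Evc.
case: (@arg_minP _ _ _ c P (fun c => (Y c - Y v) / (X c - X v)) Pc) => q /andP[Evq vq] min.
exists q; split => // d Evd vd.
have := min d; rewrite /P Evd vd => /(_ isT).
rewrite ler_pdivrMr ?subr_gt0 // mulrAC ler_pdivlMr ?subr_gt0 //.
by rewrite /orientation /cross /= subr_ge0 [X in _ <= X]mulrC.
Qed.

Definition has_right (X' : V -> R) v := [exists c, E v c && (X' v < X' c)].

(** Let vq be the lowest edge to the right of [v]. As [w] is the next visible vertex,
    [visible_before] shows that nothing between [v] and [w] lies under vq. Hence
    the edge from [w] to the left can only start at [v], and [q] is [w]. *)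
Lemma consecutive_visible v w : v \in B -> w \in B -> X v < X w ->
  (forall u, u \in B -> X v < X u -> X u < X w -> False) ->
  has_right X v -> has_right (fun x => - X x) w ->
  [/\ E v w, forall c, E v c -> X v < X c -> 0 <= orient v w c
    & forall c, E w c -> X c < X w -> 0 <= orient v w c].
Proof.
move=> vB wB vw gap /existsP[c /andP[Evc vc]] /existsP[d /andP[Ewd]].
rewrite ltrN2 => dw.
have [q [Evq vq low]] := lowest_right Evc vc.
have before := visible_before vB Evq vq low.
have Eqv : E q v by rewrite symE.
have oq : orient v q q = 0 by rewrite /orientation /cross /=; ring.
have wq : w = q.
  have [z zB /andP[vz zq]] : exists2 z', z' \in B & X v < X z' <= X q.
    by apply: before; rewrite ?oq // (touchedP Eqv).
  have wq : X w <= X q.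
    apply: le_trans zq; rewrite leNgt; apply/negP => zw; exact: (gap z).
  apply: (straight_inj H); apply/eqP; rewrite eq_le wq leNgt; apply/negP => wq'.
  have ow := visibleP wB Evq vw wq'.
  have oww : orient d w w = 0 by rewrite /orientation /cross /=; ring.
  have Edw : E d w by rewrite symE.
  have [||vd od] := @hidden_edge_starts_below v q vB Evq vq low w d w vw wq (ltW ow) Edw dw (lexx _).
  - by rewrite oww.
  - by rewrite ow.
  have [||z' z'B /andP[vz' z'd]] := before d (touchedP Edw) vd.
  - by apply: ltW; apply: lt_trans wq'.
  - exact: ltW.
  exact: (gap z' z'B vz' (le_lt_trans z'd dw)).
subst q; split => // e Ewe ew.
have Eew : E e w by rewrite symE.
case: (ltgtP (X e) (X v)) => ev.
- have := visibleP vB Eew ev vw; rewrite /orientation /cross /=; lra.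
- rewrite leNgt; apply/negP => oe.
  have [||z' z'B /andP[vz' z'e]] := before e (touchedP Eew) ev; rewrite ?ltW //.
  exact: (gap z' z'B vz' (le_lt_trans z'e ew)).
- move/(straight_inj H): ev => ->; rewrite /orientation /cross /=; lra.
Qed.

Lemma last_visible v : v \in B -> has_right X v -> exists2 w, w \in B & X v < X w.
Proof.
move=> vB /existsP[c /andP[Evc vc]].
have [q [Evq vq low]] := lowest_right Evc vc.
have Eqv : E q v by rewrite symE.
have [|z zB /andP[vz _]] := visible_before vB Evq vq low (touchedP Eqv) vq (lexx _).
  by rewrite /orientation /cross /=; lra.
by exists z.
Qed.

Lemma leftmost_visible v : v \in touched E ->
  (forall u, u \in touched E -> X v <= X u) -> v \in B.
Proof.
move=> vt min; rewrite inE vt; apply/forallP => p; apply/forallP => q.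
apply/implyP => /and3P[/touchedP /min vp pv _].
by have := le_lt_trans vp pv; rewrite ltxx.
Qed.

Lemma first_visible v : v \in B -> has_right (fun x => - X x) v ->
  exists2 w, w \in B & X w < X v.
Proof.
move=> vB /existsP[c /andP[Evc]]; rewrite ltrN2 => cv.
have ct : c \in touched E by rewrite (@touchedP _ v) // symE.
case: (arg_minP X ct) => w wt min; exists w; first exact: leftmost_visible.
exact: le_lt_trans (min _ ct) cv.
Qed.

Lemma right_triangles_eq0 X' Y' : straight X' Y' E -> forall v, ~~ has_right X' v ->
  #|right_triangles X' E v| = 0%N.
Proof.
move=> H' v nr; apply/eqP; rewrite cards_eq0; apply/set0Pn => -[S].
move=> /(right_trianglesP H')[c [d [_ [Evc _ _ _ /andP[vc _]]]]].
by case/negP: nr; apply/existsP; exists c; rewrite Evc.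
Qed.

(** The count at a visible vertex is split into a right and a left weight, so that
    the sum over B can be rearranged into pairs of successive vertices. Recording
    the presence of neighbours makes up for the triangles that hide the vertex from
    above, which need neighbours on both sides. *)
Definition right_weight (X' : V -> R) (v : V) : nat :=
  #|right_triangles X' E v| + has_right X' v.

(** If [v] or [w] has no neighbours on the relevant side its weight vanishes, and the
    other one is at most 2 + 1. Otherwise vw is an edge, lowest at both ends. Let
    a be its angle with the horizontal. By [right_triangles_turn] at [v], and at
    [w] in the drawing reflected in a vertical line, two triangles on the right of
    [v] mean a < -30 degrees, while one on the left of [w] means a > -30 degrees;
    and symmetrically. *)
Lemma consecutive_weight v w : v \in B -> w \in B -> X v < X w ->
  (forall u, u \in B -> X v < X u -> X u < X w -> False) ->
  (right_weight X v + right_weight (fun x => - X x) w <= 3 + E v w)%N.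
Proof.
move=> vB wB vw gap; have H' := straight_flipX H.
have R2 := right_triangles_le2 H v; have L2 := right_triangles_le2 H' w.
rewrite /right_weight.
have [hr|nr] := boolP (has_right X v); last first.
  rewrite (right_triangles_eq0 H nr) add0n; move: L2; move: #|_| => m; by case: (has_right _ _); case: (E v w) => /=; lia.
have [hl|nl] := boolP (has_right _ w); last first.
  rewrite (right_triangles_eq0 H' nl); move: R2; move: #|_| => m; by case: (E v w) => /=; lia.
have [Evw lowv loww] := consecutive_visible vB wB vw gap hr hl.
have [t1 t2] := right_triangles_turn H vw lowv.
have nwv : - X w < - X v by rewrite ltrN2.
have low' c : E w c -> - X w < - X c -> 0 <= orientation (fun x => - X x) Y w v c.
  rewrite ltrN2 => Ewc cw; have := loww c Ewc cw.
  by rewrite /orientation /cross /=; lra.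
have [s1 s2] := right_triangles_turn H' nwv low'.
have sum4 n m : (n <= 2)%N -> (m <= 2)%N -> ((0 < n)%N -> (1 < m)%N -> False) ->
  ((1 < n)%N -> (0 < m)%N -> False) -> (n + m <= 2)%N.
  by move: n m => [|[|[|n]]] // [|[|[|m]]] // _ _ e1 e2; case: (e1 isT isT) || case: (e2 isT isT).
rewrite Evw addnACA -[(3 + true)%N]/(2 + 2)%N -[(true + true)%N]/2%N leq_add2r sum4 //.
- by move=> /t1 + /s2; rewrite /turn60_x /turn120_x; lra.
- by move=> /t2 + /s1; rewrite /turn60_x /turn120_x; lra.
Qed.

Definition triangles_at v : {set {set V}} := [set S in triangles E | v \in S].

(** A triangle at [v] is on its right, on its left, or has [v] as middle vertex. In the
    last case it does not hide [v] from below, so it hides [v] from above; there is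
    at most one such triangle, and then [v] has neighbours on both sides. *)
Lemma triangles_at_weight v : v \in B ->
  (#|triangles_at v| + 1 <= right_weight X v + right_weight (fun x => - X x) v)%N.
Proof.
move=> vB; have H' := straight_flipX H; have H'' := straight_flipY H.
have U1 := hanging_triangles_le1 H'' v.
have cover : triangles_at v \subset
  right_triangles X E v :|: right_triangles (fun x => - X x) E v :|:
  hanging_triangles X (fun x => - Y x) E v.
  apply/subsetP => S; rewrite inE => /andP[ST vS].
  have [a [b [Sab Eva Evb Eab o]]] := trianglesP H ST vS.
  have aS : a \in S by rewrite Sab !inE eqxx orbT.
  have bS : b \in S by rewrite Sab !inE eqxx !orbT.
  have va : X v != X a by apply: X_neq H _ _ (edge_neq H Eva).
  have vb : X v != X b by apply: X_neq H _ _ (edge_neq H Evb).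
  have cov x : x \in S -> x != v -> (x == a) || (x == b).
    by rewrite Sab !inE -orbA => /orP[->|].
  have roof l r : E l r -> l \in S -> r \in S -> X l < X v -> X v < X r ->
    S \in hanging_triangles X (fun x => - Y x) E v.
    move=> Elr lS rS lv vr; rewrite inE ST vS; apply/exists_inP; exists l => //.
    apply/exists_inP; exists r => //; rewrite lv vr /=.
    have := visibleP vB Elr lv vr; rewrite /orientation /cross /=; lra.
  have right (X' : V -> R) : X' v < X' a -> X' v < X' b -> S \in right_triangles X' E v.
    move=> va' vb'; rewrite inE ST /leftmost_in vS; apply/forall_inP => u uS.
    by apply/implyP => /(cov _ uS) /orP[] /eqP ->.
  rewrite 2!in_setU.
  case: (ltgtP (X v) (X a)) (va) => // va' _; case: (ltgtP (X v) (X b)) (vb) => // vb' _.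
  - by rewrite right.
  - by rewrite (roof b a) ?orbT // symE.
  - by rewrite (roof a b) ?orbT.
  - by rewrite (right (fun x => - X x)) ?orbT // ltrN2.
have le := leq_trans (subset_leq_card cover)
  (leq_trans (leq_card_setU _ _) (leq_add (leq_card_setU _ _) (leqnn _))).
have t : (0 < has_right X v + has_right (fun x => - X x) v)%N.
  have /existsP[w Evw] : [exists w, E v w].
    by move: vB; rewrite inE => /andP[]; rewrite inE.
  have := X_neq H (edge_neq H Evw); rewrite neq_lt => /orP[vw|wv].
    have -> : has_right X v by apply/existsP; exists w; rewrite Evw.
    by [].
  have -> : has_right (fun x => - X x) v.
    by apply/existsP; exists w; rewrite Evw ltrN2.
  by rewrite addn1.
have u : (0 < #|hanging_triangles X (fun x => - Y x) E v|)%N ->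
   has_right X v && has_right (fun x => - X x) v.
  move=> /card_gt0P[S /hanging_trianglesP[l [r [_ Evl Evr _ [lv vr _]]]]].
  apply/andP; split; apply/existsP; first by exists r; rewrite Evr.
  by exists l; rewrite Evl ltrN2.
rewrite /right_weight.
move: le t u U1; move: #|_| #|_| #|_| #|_| => c b a n.
case: (has_right X v); case: (has_right _ v) => //=; case: c => [|c] //=;
  move=> le t u U1; try lia; try (by have := u isT).
Qed.

End Visible.

(** * Peeling off the visible vertices *)

Lemma path_weight (T : eqType) (A L F : T -> nat) (x : T) (s : seq T) (c : nat) :
  path (fun v w => A v + L w <= c + F w)%N x s ->
  (\sum_(v <- x :: s) (A v + L v) <= L x + A (last x s) + c * size s
     + \sum_(w <- s) F w)%N.
Proof.
elim: s x => [|y s IH] x /=; first by rewrite big_seq1 big_nil muln0; lia.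
move=> /andP[xy /IH le]; rewrite big_cons [in leqRHS]big_cons mulnS.
move: le; move: (bigop _ _ _) => n; move: (bigop _ _ _) => m; lia.
Qed.

Section Peel.
Variables (R : rcfType) (V : finType) (X Y : V -> R) (E : rel V).
Hypothesis H : straight X Y E.
Hypothesis tri : forall u v, E u v -> exists2 S, S \in triangles E & (u \in S) && (v \in S).
Local Notation B := (lower_envelope X Y E).
Local Notation A := (right_weight E X).
Local Notation L := (right_weight E (fun x => - X x)).

Let symE : symmetric E := straight_sym H.

(** Attached vertices offset the triangles that are counted at several vertices of B. *)
Definition attached : {set V} := [set w in B | [exists v in B, E v w && (X v < X w)]].

(** Regroup the weights along the increasing enumeration of B: each of its |B| - 1
    steps contributes at most 3, plus 1 when its right end is attached, and the
    outer weights of the first and of the last vertex vanish. *)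
Lemma weight_sum : B != set0 ->
  (\sum_(v in B) (A v + L v) + 3 <= 3 * #|B| + #|attached|)%N.
Proof.
move=> B0.
pose leX : rel V := fun u v => X u <= X v.
pose s := sort leX (enum B).
have s_mem v : (v \in s) = (v \in B) by rewrite mem_sort mem_enum.
have s_size : size s = #|B| by rewrite size_sort -cardE.
have s_uniq : uniq s by rewrite sort_uniq enum_uniq.
have s_sum (F : V -> nat) : (\sum_(v in B) F v = \sum_(v <- s) F v)%N.
  by rewrite [RHS](perm_big (enum B)) /= ?perm_sort // big_enum.
have s_sort : sorted leX s.
  by apply: sort_sorted => u v; rewrite /leX le_total.
have sB v : v \in s -> v \in B by rewrite s_mem.
rewrite -s_size s_sum.
move: s_mem s_size s_sum s_uniq s_sort sB; case: s => [|x s] s_mem s_size s_sum s_uniq s_sort sB.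
  by case/set0Pn: B0 => v; rewrite -s_mem.
have s_lt i j : (i < j)%N -> (j < (size s).+1)%N -> X (nth x (x :: s) i) < X (nth x (x :: s) j).
  move=> ij js; rewrite lt_neqAle; apply/andP; split.
    apply: (X_neq H); rewrite nth_uniq //; first by rewrite neq_ltn ij.
    exact: ltn_trans js.
  have tr : transitive leX by move=> a b c; exact: le_trans.
  have := @sorted_ltn_nth _ leX tr x _ s_sort i j; apply => //.
  exact: ltn_trans js.
have p : path (fun v w => A v + L w <= 3 + (w \in attached))%N x s.
  apply/(pathP x) => i si.
  have vB : nth x (x :: s) i \in B by apply/sB/mem_nth; rewrite /= ltnW.
  have wB : nth x (x :: s) i.+1 \in B by apply/sB/mem_nth.
  have vw := s_lt i i.+1 (ltnSn i) si.
  apply: leq_trans (consecutive_weight H vB wB vw _) _.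
    move=> u uB; have : u \in x :: s by rewrite s_mem.
    move=> /(nthP x)[j js <-] ij ji.
    case: (ltngtP i j) => [lij|lji|eij].
    - have [lij'|] := ltnP i.+1 j.
        by have := s_lt _ _ lij' js; rewrite ltNge ltW.
      by move=> jle; move: ji; rewrite (_ : j = i.+1) ?ltxx //; apply/eqP; rewrite eqn_leq jle.
    - by have := s_lt _ _ lji (ltnW si); rewrite ltNge ltW.
    - by move: ij; rewrite eij ltxx.
  rewrite leq_add2l; case Evw: (E _ _) => //; rewrite lt0b inE wB /=.
  by apply/exists_inP; exists (nth x (x :: s) i) => //; rewrite Evw.
have := path_weight p.
have -> : L x = 0%N.
  have xB : x \in B by apply: sB; rewrite inE eqxx.
  have hl : ~~ has_right E (fun x => - X x) x.
    apply/negP => /(first_visible H xB)[w]; rewrite -s_mem => /(nthP x)[[|j] js <-].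
      by rewrite ltxx.
    by have := s_lt 0%N j.+1 isT js; rewrite ltNge => /negP nlt /ltW.
  by rewrite /right_weight (negbTE hl) (right_triangles_eq0 (straight_flipX H) hl).
have -> : A (last x s) = 0%N.
  have xB : last x s \in B by apply: sB; exact: mem_last.
  have hl : ~~ has_right E X (last x s).
    apply/negP => /(last_visible H xB)[w]; rewrite -s_mem => /(nthP x)[j js <-].
    rewrite (last_nth x); have := js; rewrite /= ltnS leq_eqVlt => /orP[/eqP->|lj].
      by rewrite ltxx.
    by have := s_lt _ _ lj (ltnSn _); rewrite ltNge => /negP nlt /ltW.
  by rewrite /right_weight (negbTE hl) (right_triangles_eq0 H hl).
have : (\sum_(w <- s) (w \in attached) <= #|attached|)%N.
  have u : uniq [seq w <- s | w \in attached].
    by apply: filter_uniq; move: s_uniq => /= /andP[].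
  have -> : (\sum_(w <- s) (w \in attached))%N = size [seq w <- s | w \in attached].
    by rewrite size_filter -sum1_count [RHS]big_mkcond; apply: eq_bigr => w _; case: (_ \in _).
  rewrite -(card_uniqP u); apply: subset_leq_card; apply/subsetP => w.
  by rewrite mem_filter => /andP[].
by rewrite /= mulnS; lia.
Qed.

Definition peeled (C : {set V}) : {set {set V}} := [set S in triangles E | S :&: C != set0].

(** A triangle S with k > 0 vertices in B is counted k times on the right-hand side.
    Its leftmost vertex in B accounts for S itself; the k - 1 others account for the
    attached vertices whose edge to the left lies in S. *)
Lemma peeled_attached :
  (#|peeled B| + #|attached| <= \sum_(v in B) #|triangles_at E v|)%N.
Proof.
have -> : (\sum_(v in B) #|triangles_at E v| = \sum_(S in triangles E) #|S :&: B|)%N.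
  under eq_bigr do rewrite -sum1_card.
  rewrite (exchange_big_dep (mem (triangles E))) /=; last first.
    by move=> v S _; rewrite inE => /andP[].
  apply: eq_bigr => S ST; rewrite -sum1_card; apply: eq_bigl => v.
  by rewrite in_setI [S \in triangles_at _ _]inE ST andbC.
pose N S := [set w in S :&: B | [exists v in S :&: B, X v < X w]].
have U : attached \subset \bigcup_(S in triangles E) N S.
  apply/subsetP => w; rewrite inE => /andP[wB /exists_inP[v vB /andP[Evw vw]]].
  have [S ST /andP[vS wS]] := tri Evw.
  apply/bigcupP; exists S => //; rewrite inE in_setI wS wB /=.
  by apply/exists_inP; exists v => //; rewrite in_setI vS vB.
have le : (#|attached| <= \sum_(S in triangles E) #|N S|)%N.
  apply: leq_trans (subset_leq_card U) _.
  elim/big_rec2: _ => [|S n C _ le]; first by rewrite cards0.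
  apply: leq_trans (leq_card_setU _ _) _; exact: leq_add.
have -> : #|peeled B| = (\sum_(S in triangles E) (S :&: B != set0))%N.
  rewrite -sum1_card [RHS]big_mkcond [LHS]big_mkcond /=; apply: eq_bigr => S _.
  by rewrite [S \in peeled _]inE; case: (S \in triangles E); case: (_ != set0).
apply: leq_trans (leq_add (leqnn _) le) _; rewrite -big_split /=.
apply: leq_sum => S _; have [e|n0] := eqVneq (S :&: B) set0.
  by rewrite (_ : N S = set0) ?cards0 //; apply/setP => w; rewrite [w \in N S]inE e !in_set0.
rewrite add1n; apply: proper_card; apply/properP; split.
  by apply/subsetP => w; rewrite inE => /andP[].
have /set0Pn[v0 v0S] := n0.
case: (arg_minP X v0S) => v vS min; have {}vS : v \in S :&: B := vS.
exists v => //; rewrite [v \in N S]inE vS /=.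
by apply/negP => /exists_inP[u uS]; rewrite ltNge min.
Qed.

(** With m = |B|, the sum of the numbers of triangles at the vertices of B is at most
    3m - 3 + |attached| - m by [weight_sum], and at least |peeled| + |attached|. *)
Lemma peeled_bound : B != set0 -> (#|peeled B| + 3 <= 2 * #|B|)%N.
Proof.
move=> B0; have := weight_sum B0; have := peeled_attached.
have : (\sum_(v in B) #|triangles_at E v| + #|B| <= \sum_(v in B) (A v + L v))%N.
  rewrite -[X in (_ + X <= _)%N]sum1_card -big_split /=; apply: leq_sum => v vB.
  exact: triangles_at_weight H _ vB.
lia.
Qed.

Lemma middle_vertex S : S \in triangles E -> exists2 v, v \in touched E &
  (S \in hanging_triangles X Y E v) || (S \in hanging_triangles X (fun x => - Y x) E v).
Proof.
move=> ST.
have /set0Pn[v0 v0S] : S != set0.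
  by move: (ST); rewrite inE => /andP[/eqP S3 _]; rewrite -card_gt0 S3.
case: (arg_minP X v0S) => l lS min {v0 v0S}; have {}lS : l \in S := lS.
have [a [b [Sab Ela Elb Eab o]]] := trianglesP H ST lS.
have aS : a \in S by rewrite Sab !inE eqxx orbT.
have bS : b \in S by rewrite Sab !inE eqxx !orbT.
have key m r : m \in S -> r \in S -> E l m -> E l r -> E m r -> X m < X r ->
  exists2 v, v \in touched E &
  (S \in hanging_triangles X Y E v) || (S \in hanging_triangles X (fun x => - Y x) E v).
  move=> mS rS Elm Elr Emr mr; exists m; first exact: touchedP Emr.
  have lm : X l < X m by rewrite lt_neqAle min // andbT; apply: (X_neq H); exact: edge_neq H _ _ Elm.
  have := orient_neq0 H Elr Elm; rewrite symE => /(_ Emr); rewrite neq_lt => /orP[o'|o'].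
    apply/orP; right; rewrite inE ST mS; apply/exists_inP; exists l => //.
    apply/exists_inP; exists r => //; rewrite lm mr /=.
    by move: o'; rewrite /orientation /cross /=; lra.
  apply/orP; left; rewrite inE ST mS; apply/exists_inP; exists l => //.
  by apply/exists_inP; exists r => //; rewrite lm mr /=.
have := X_neq H (edge_neq H Eab); rewrite neq_lt => /orP[ab|ba].
  exact: (key a b).
by apply: (key b a) => //; rewrite symE.
Qed.

Lemma hanging_lower v : v \in B -> hanging_triangles X Y E v = set0.
Proof.
move=> vB; apply/setP => S; rewrite in_set0; apply/negP.
rewrite inE => /andP[ST /andP[vS /exists_inP[l lS /exists_inP[r rS /and3P[lv vr o]]]]].
have Elr : E l r.
  move: ST; rewrite inE => /andP[_ /forall_inP/(_ _ lS)/forall_inP/(_ _ rS)/implyP]; apply.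
  by apply: contraTneq (lt_trans lv vr) => ->; rewrite ltxx.
by have := visibleP vB Elr lv vr; rewrite ltNge ltW.
Qed.

End Peel.

(** Each triangle hides its middle vertex from below or from above. A vertex is
    hidden from either side by at most one triangle, and by none from a side from
    which it is visible. *)
Lemma lower_upper_bound (R : rcfType) (V : finType) (X Y : V -> R) (E : rel V) :
  straight X Y E ->
  (#|lower_envelope X Y E| + #|lower_envelope X (fun v => - Y v) E| + #|triangles E|
    <= 2 * #|touched E|)%N.
Proof.
move=> H; have H' := straight_flipY H.
pose D Y v := hanging_triangles X Y E v.
have le : (#|triangles E| <= \sum_(v in touched E) (#|D Y v| + #|D (fun x => - Y x) v|))%N.
  have sub : triangles E \subset \bigcup_(v in touched E) (D Y v :|: D (fun x => - Y x) v).
    apply/subsetP => S /(middle_vertex H)[v vt Sv].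
    by apply/bigcupP; exists v => //; rewrite in_setU.
  apply: leq_trans (subset_leq_card sub) _.
  elim/big_rec2: _ => [|v n C _ le]; first by rewrite cards0.
  apply: leq_trans (leq_card_setU _ _) _; apply: leq_add => //.
  exact: leq_card_setU.
have card_lower Y' : #|lower_envelope X Y' E| = (\sum_(v in touched E) (v \in lower_envelope X Y' E))%N.
  rewrite -sum1_card [RHS]big_mkcond [LHS]big_mkcond /=; apply: eq_bigr => v _.
  by rewrite [v \in lower_envelope _ _ _]inE; case: (v \in touched E) => //=; case: visible.
rewrite !card_lower mulnC -sum_nat_const -big_split /=.
apply: leq_trans (leq_add (leqnn _) le) _; rewrite -big_split /=.
apply: leq_sum => v _; rewrite addnACA -[2%N]/(1 + 1)%N.
have one Y' : straight X Y' E -> ((v \in lower_envelope X Y' E) + #|D Y' v| <= 1)%N.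
  move=> HY; case: (boolP (v \in _)) => [/(hanging_lower)|_] /=.
    by rewrite /D => ->; rewrite cards0.
  exact: hanging_triangles_le1 HY v.
by apply: leq_add; apply: one.
Qed.

(** The induction step, with a vertices and t triangles, after removal of k vertices
    and r triangles. Put f = 2a - 2 - t = f' + d' with d' = 2k - r >= 3. Since
    2k <= f + 2, we get 6t = 6t' + 12k - 6d' <= f'^2 + 6f' + 12, which is at most
    (f' + d')^2 if d' >= 4, and also if d' = 3 and 2k <= f + 1. In the remaining case
    f' and t' are odd, so f'^2 - 6t' is congruent to 3 modulo 4, hence at least 3,
    and this makes up for the missing 3. *)
Lemma peel_arith (a k t t' f' r : nat) :
  (t' + f' + 2 = 2 * (a - k) -> k < a -> 6 * t' <= f' ^ 2 -> r + 3 <= 2 * k ->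
  t = t' + r -> 2 * k + t <= 2 * a ->
  exists f, t + f + 2 = 2 * a /\ 6 * t <= f ^ 2)%N.
Proof.
move=> e ka le r3 -> kt; exists (f' + 2 * k - r)%N; split; first by lia.
(* here d stands for the excess 2k - r - 3 *)
have [d dE] : exists d, (2 * k = r + 3 + d)%N by exists (2 * k - (r + 3))%N; lia.
have -> : (f' + 2 * k - r = f' + 3 + d)%N by lia.
have kf : (2 * k <= f' + 3 + d + 2)%N by lia.
have exp2 x y : ((x + y) ^ 2 = x ^ 2 + 2 * x * y + y ^ 2)%N by rewrite sqrnD; lia.
have [d0|] := posnP d; last first.
  case: d dE kf => // d dE kf _; rewrite !exp2.
  have : (2 * (f' + 3) * 1 <= 2 * (f' + 3) * d.+1)%N by rewrite leq_mul2l orbT.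
  by lia.
subst d; rewrite addn0 exp2.
have [kf'|kf'] := ltnP (2 * k) (f' + 5); first by lia.
have rE : (r = f' + 2)%N by lia.
have odd_f : odd f' by lia.
have [g gE] : exists g, f' = (2 * g).+1 by exists f'./2; lia.
have [s sE] : exists s, t' = (2 * s).+1 by exists t'./2; lia.
have f2 : (f' ^ 2 = 4 * (g * g) + 4 * g + 1)%N by rewrite gE -[(2 * g).+1]addn1 exp2; lia.
by move: le; rewrite f2; move: (g * g)%N => g2; lia.
Qed.

(** * The bound on the number of triangles *)

Section Induction.
Variables (R : rcfType) (V : finType) (X Y : V -> R) (E : rel V).
Hypothesis H : straight X Y E.

Definition triangles_in (A : {set V}) : {set {set V}} :=
  [set S in triangles E | S \subset A].

(** Peeling requires that every edge lie in a triangle. *)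
Definition triangle_edge (A : {set V}) : rel V := fun u v =>
  [exists S in triangles_in A, [&& u \in S, v \in S & u != v]].

Lemma triangle_edgeP A u v : triangle_edge A u v ->
  exists S, [/\ S \in triangles E, S \subset A, u \in S, v \in S & u != v].
Proof.
by move=> /exists_inP[S]; rewrite inE => /andP[ST SA] /and3P[uS vS uv]; exists S.
Qed.

Lemma straight_triangle_edge A : straight X Y (triangle_edge A).
Proof.
apply: straight_subrel H.
  move=> u v; apply/exists_inP/exists_inP => -[S ST /and3P[uS vS uv]];
  by exists S; rewrite // uS vS eq_sym.
move=> u v /triangle_edgeP[S [ST _ uS vS uv]].
by move: ST; rewrite inE => /andP[_ /forall_inP/(_ _ uS)/forall_inP/(_ _ vS)/implyP]; apply.
Qed.

Lemma triangles_triangle_edge A : triangles (triangle_edge A) = triangles_in A.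
Proof.
apply/setP => S; apply/idP/idP; last first.
  move=> SA; move: (SA); rewrite inE => /andP[+ _]; rewrite !inE => /andP[-> _] /=.
  apply/forall_inP => u uS; apply/forall_inP => v vS; apply/implyP => uv.
  by apply/exists_inP; exists S => //; rewrite uS vS.
rewrite inE => /andP[S3 /forall_inP cl].
rewrite inE; apply/andP; split.
  rewrite inE S3; apply/forall_inP => u uS; apply/forall_inP => v vS.
  apply/implyP => uv; have := cl _ uS => /forall_inP/(_ _ vS); rewrite uv /=.
  move=> /triangle_edgeP[S' [S'T _ uS' vS' _]].
  by move: S'T; rewrite inE => /andP[_ /forall_inP/(_ _ uS')/forall_inP/(_ _ vS')/implyP]; apply.
apply/subsetP => u uS.
have [v vS uv] : exists2 v, v \in S & u != v.
  have /card_gt0P[v] : (0 < #|S :\ u|)%N by move: S3; rewrite (cardsD1 u) uS => /eqP; lia.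
  by rewrite !inE => /andP[vu vS]; exists v; rewrite // eq_sym.
have := cl _ uS => /forall_inP/(_ _ vS); rewrite uv /=.
by move=> /triangle_edgeP[S' [_ /subsetP sub uS' _ _]]; exact: sub.
Qed.

Lemma touched_sub A : touched (triangle_edge A) \subset A.
Proof.
apply/subsetP => u; rewrite inE => /existsP[v /triangle_edgeP[S [_ /subsetP sub uS _ _]]].
exact: sub.
Qed.

Lemma triangles_in_touched A S v : S \in triangles_in A -> v \in S ->
  v \in touched (triangle_edge A).
Proof.
move=> SA vS; rewrite inE; apply/existsP.
have S3 : #|S| == 3%N by move: SA; rewrite inE => /andP[]; rewrite inE => /andP[].
have /card_gt0P[w] : (0 < #|S :\ v|)%N by move: S3; rewrite (cardsD1 v) vS => /eqP; lia.
rewrite !inE => /andP[wv wS]; exists w; apply/exists_inP; exists S => //.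
by rewrite vS wS eq_sym.
Qed.

Lemma lower_envelope_neq0 (Y' : V -> R) (E' : rel V) : touched E' != set0 ->
  straight X Y' E' -> lower_envelope X Y' E' != set0.
Proof.
move=> /set0Pn[v vt] H'; case: (arg_minP X vt) => w wt min.
by apply/set0Pn; exists w; apply: leftmost_visible.
Qed.

(** A vertex of [A] outside all triangles can be deleted, since f drops by 2 and t is
    unchanged. Otherwise peel off the vertices visible from below or those visible
    from above, whichever are fewer. *)
Lemma triangles_in_bound A : A != set0 -> exists f,
  (#|triangles_in A| + f + 2 = 2 * #|A| /\ 6 * #|triangles_in A| <= f ^ 2)%N.
Proof.
have [n] := ubnP #|A|; elim: n => // n IH in A *; rewrite ltnS => An A0.
have [Et|/subsetPn[v vA vt]] := boolP (A \subset touched (triangle_edge A)); last first.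
  have tE : triangles_in A = triangles_in (A :\ v).
    apply/setP => S; apply/idP/idP => [SA|].
      move: (SA); rewrite inE => /andP[ST Ssub]; rewrite inE ST subsetD1 Ssub.
      by apply: contra vt; exact: triangles_in_touched.
    rewrite !inE => /andP[-> ] /subset_trans; apply; exact: subD1set.
  have cA := cardsD1 v A; rewrite vA in cA.
  have [A'0|A'0] := eqVneq (A :\ v) set0.
    exists 0%N; rewrite tE A'0; have -> : triangles_in set0 = set0.
      apply/setP => S; rewrite in_set0; apply/negP; rewrite inE => /andP[].
      by rewrite inE subset0 => /andP[/eqP S3 _] /eqP S0; rewrite S0 cards0 in S3.
    by rewrite cA A'0 !cards0.
  have [|f [fE f2]] := IH _ _ A'0; first by lia.
  exists f.+2; rewrite tE; split; first by lia.
  by apply: leq_trans f2 _; rewrite leq_exp2r //; lia.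
have tA : touched (triangle_edge A) = A by apply/eqP; rewrite eqEsubset touched_sub.
have HA := straight_triangle_edge A; have HA' := straight_flipY HA.
have tri u v : triangle_edge A u v ->
    exists2 S, S \in triangles (triangle_edge A) & (u \in S) && (v \in S).
  move=> /exists_inP[S SA /and3P[uS vS _]].
  by exists S; rewrite ?triangles_triangle_edge ?uS.
have t0 : (0 < #|triangles_in A|)%N.
  have /set0Pn[v] := A0; rewrite -{1}tA inE => /existsP[w].
  by move=> /exists_inP[S SA _]; apply/card_gt0P; exists S.
have both := lower_upper_bound HA; rewrite tA triangles_triangle_edge in both.
have peel Y' : straight X Y' (triangle_edge A) ->
    let B := lower_envelope X Y' (triangle_edge A) in
    (2 * #|B| + #|triangles_in A| <= 2 * #|A|)%N ->
    exists f, (#|triangles_in A| + f + 2 = 2 * #|A| /\ 6 * #|triangles_in A| <= f ^ 2)%N.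
  move=> HY B le2.
  have B0 : B != set0 by apply: lower_envelope_neq0 => //; rewrite tA.
  have BA : B \subset A.
    by rewrite -tA; apply/subsetP => v; rewrite inE => /andP[].
  have r3 := peeled_bound HY tri B0.
  have cD := cardsDS BA; have cB : (#|B| < #|A|)%N by lia.
  have c0 : (0 < #|B|)%N by rewrite card_gt0.
  have [||f' [fE f2]] := IH (A :\: B).
  - by lia.
  - by rewrite -card_gt0; lia.
  rewrite cD in fE; apply: (peel_arith fE cB f2 r3 _ le2).
  rewrite -(cardsID (triangles_in (A :\: B)) (triangles_in A)); congr (_ + _)%N.
    apply: eq_card => S; rewrite in_setI; apply: andb_idl; rewrite !inE => /andP[-> sub].
    exact: subset_trans sub (subsetDl _ _).
  apply: eq_card => S; rewrite in_setD [S \in peeled _ _]inE triangles_triangle_edge andbC.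
  case SA : (S \in triangles_in A) => //=; congr negb; move: SA; rewrite !inE => /andP[-> SA] /=.
  by rewrite subsetD SA setI_eq0.
have [le|/ltnW le] := leqP #|lower_envelope X Y (triangle_edge A)| #|lower_envelope X (fun v => - Y v) (triangle_edge A)|.
  by apply: peel HA _; apply: leq_trans both; rewrite leq_add2r mul2n -addnn leq_add2l.
by apply: peel HA' _; apply: leq_trans both; rewrite leq_add2r mul2n -addnn leq_add2r.
Qed.

End Induction.

(** * Planar sets *)

From mathcomp Require Import finmap all_classical all_reals all_analysis.

Import numFieldNormedType.Exports.

Local Open Scope classical_set_scope.
Local Open Scope ring_scope.

Section Plane.
Variable R : realType.
Implicit Types (a b c p q z w : R * R) (A C D F : set (R * R)).

Definition mix (t : R) a b : R * R :=
  ((1 - t) * a.1 + t * b.1, (1 - t) * a.2 + t * b.2).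

Lemma mix0 a b : mix 0 a b = a.
Proof. by case: a => ? ?; rewrite /mix subr0 !mul1r !mul0r !addr0. Qed.

Lemma mix1 a b : mix 1 a b = b.
Proof. by case: b => ? ?; rewrite /mix subrr !mul1r !mul0r !add0r. Qed.

Lemma mix_continuous a b : continuous (fun t : R => mix t a b).
Proof.
move=> t; apply: (@cvg_pair _ _ _ _ (nbhs ((1 - t) * a.1 + t * b.1))
  (nbhs ((1 - t) * a.2 + t * b.2))) => /=.
- by apply: cvgD; apply: cvgM; [apply: cvgB; [exact: cvg_cst|exact: cvg_id]|exact: cvg_cst|exact: cvg_id|exact: cvg_cst].
- by apply: cvgD; apply: cvgM; [apply: cvgB; [exact: cvg_cst|exact: cvg_id]|exact: cvg_cst|exact: cvg_id|exact: cvg_cst].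
Qed.

Lemma segmentE a b : segment a b = (fun t => mix t a b) @` `[0, 1].
Proof. by []. Qed.

Lemma segment_closed a b : closed (segment a b).
Proof.
apply: compact_closed; first exact: norm_hausdorff.
rewrite segmentE; apply: continuous_compact; last exact: segment_compact.
by apply: continuous_subspaceT => t; exact: mix_continuous.
Qed.

Lemma plane_segment_connected a b : connected (segment a b).
Proof.
rewrite segmentE; apply: connected_continuous_connected; first exact: segment_connected.
by apply: continuous_subspaceT => t; exact: mix_continuous.
Qed.

Definition convex_set2 C := forall a b t, C a -> C b -> 0 <= t <= 1 -> C (mix t a b).

Lemma convex_set2_connected C : convex_set2 C -> connected C.
Proof.
move=> cC; have [->|/set0P[a Ca]] := eqVneq C set0; first exact: connected0.
have -> : C = \bigcup_(b in C) segment a b.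
  apply/seteqP; split=> z.
    move=> Cz; exists z => //; exists 1; last exact: mix1.
    by rewrite /= in_itv /= ler01 lexx.
  by move=> [b Cb [t t01 <-]]; apply: cC => //; move: t01; rewrite /= in_itv.
apply: bigcup_connected => [|b _]; last exact: plane_segment_connected.
by exists a => b _; exists 0; [rewrite /= in_itv /= ler01 lexx|exact: mix0].
Qed.

(** The balls of the max norm. *)
Definition square z (r : R) : set (R * R) :=
  [set w | `|z.1 - w.1| < r /\ `|z.2 - w.2| < r].

Lemma nbhs_squareP z A : nbhs z A <-> exists2 r, 0 < r & square z r `<=` A.
Proof. exact: nbhs_ballP. Qed.

Lemma convex_square z r : convex_set2 (square z r).
Proof.
move=> a b t [a1 a2] [b1 b2] /andP[t0 t1]; move: a1 a2 b1 b2.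
rewrite /square /= !ltr_norml => /andP[? ?] /andP[? ?] /andP[? ?] /andP[? ?].
have [t00|t00] := eqVneq t 0; first by subst t; rewrite !subr0 !mul1r !mul0r !addr0; split; apply/andP.
have t0' : 0 < t by rewrite lt_neqAle eq_sym t00.
by split; apply/andP; split; nra.
Qed.

Lemma crossD p q a b t : cross p q (mix t a b) = (1 - t) * cross p q a + t * cross p q b.
Proof. by rewrite /cross /mix /=; ring. Qed.

Lemma cross_rev p q z : cross q p z = - cross p q z.
Proof. by rewrite /cross; ring. Qed.

Lemma cross_mix_side a b t : cross a b (mix t a b) = 0.
Proof. by rewrite /cross /mix /=; ring. Qed.

Lemma cross_rot a b c : cross b c a = cross a b c.
Proof. by rewrite /cross; ring. Qed.

Definition left_of p q : set (R * R) := [set z | 0 < cross p q z].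

Lemma convex_left p q : convex_set2 (left_of p q).
Proof.
move=> a b t a0 b0 /andP[t0 t1]; rewrite /left_of /= crossD.
have [->|t00] := eqVneq t 0; first by rewrite subr0 mul1r mul0r addr0.
have t0' : 0 < t by rewrite lt_neqAle eq_sym t00.
apply: ltr_wpDl; last exact: mulr_gt0.
by apply: mulr_ge0; [rewrite subr_ge0|exact: ltW].
Qed.

Lemma convexI A C : convex_set2 A -> convex_set2 C -> convex_set2 (A `&` C).
Proof. by move=> cA cC a b t [? ?] [? ?] t01; split; [exact: cA|exact: cC]. Qed.

Definition shift_left p q (e : R) z : R * R := (z.1 - e * (q.2 - p.2), z.2 + e * (q.1 - p.1)).

Definition len2 p q : R := (q.1 - p.1) ^+ 2 + (q.2 - p.2) ^+ 2.

Lemma cross_shift p q e z : cross p q (shift_left p q e z) = cross p q z + e * len2 p q.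
Proof. by rewrite /cross /shift_left /len2 /=; ring. Qed.

Lemma len2_gt0 p q : p != q -> 0 < len2 p q.
Proof.
case: p q => [p1 p2] [q1 q2] ne; rewrite /len2 /= lt_neqAle addr_ge0 ?sqr_ge0 // andbT.
rewrite eq_sym paddr_eq0 ?sqr_ge0 // !sqrf_eq0 !subr_eq0; apply: contra ne.
by move=> /andP[/eqP-> /eqP->].
Qed.

Lemma shift_square p q z r : 0 < r -> exists2 e, 0 < e &
  square z r (shift_left p q e z) /\ square z r (shift_left p q (- e) z).
Proof.
move=> r0; pose m := `|q.1 - p.1| + `|q.2 - p.2| + 1.
have m0 : 0 < m by rewrite ltr_wpDl // addr_ge0.
have e0 : 0 < r / m by rewrite divr_gt0.
have lt x : `|x| < m -> `|r / m * x| < r.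
  move=> xm; rewrite normrM (gtr0_norm e0) mulrAC ltr_pdivrMr //.
  by rewrite ltr_pM2l.
have l1 : `|q.1 - p.1| < m by rewrite /m -addrA ltrDl ltr_wpDl.
have l2 : `|q.2 - p.2| < m by rewrite /m addrAC ltr_pwDl // ltr_wpDl.
exists (r / m) => //; split; rewrite /square /shift_left /=; split.
- by rewrite opprB addrCA subrr addr0; exact: lt.
- by rewrite opprD addNKr normrN; exact: lt.
- by rewrite mulNr opprK opprD addNKr normrN; exact: lt.
- by rewrite mulNr opprB addrCA subrr addr0; exact: lt.
Qed.

End Plane.

(** * Bounded regions with triangular boundary *)

Section Region.
Variable R : realType.
Implicit Types (a b c p q z w : R * R) (A C : set (R * R)).

(** What is used of a connected component [F] of the complement of a closed set [D]. *)
Record region (D F : set (R * R)) : Prop := Region {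
  region_open : open F;
  region_off : forall z, F z -> ~ D z;
  region_max : forall C, connected C -> C `<=` ~` D -> C `&` F !=set0 -> C `<=` F;
  region_closure : forall z, closure F z -> ~ D z -> F z }.

(** A point off [D] has a square neighbourhood off [D], which is connected and thus lies
    in [F] as soon as it meets [F]. *)
Lemma component_region D z : closed D -> (~` D) z -> region D (connected_component (~` D) z).
Proof.
move=> cD Dz; set F := connected_component _ _.
have off w : F w -> ~ D w by move=> /connected_component_sub.
have max C : connected C -> C `<=` ~` D -> C `&` F !=set0 -> C `<=` F.
  move=> cC CD [w [Cw Fw]].
  rewrite /F (same_connected_component Fw); exact: connected_component_max.
have sq w : ~ D w -> exists2 r, 0 < r & square w r `<=` ~` D.
  by move=> Dw; apply/nbhs_squareP; apply: open_nbhs_nbhs; split => //; exact: closed_openC.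
have sqc w r : connected (square w r) by apply: convex_set2_connected; exact: convex_square.
split => //.
- rewrite openE => w Fw; have [r r0 rD] := sq _ (off _ Fw).
  apply/nbhs_squareP; exists r => //; apply: max => //; exists w; split=> //.
  by rewrite /square /= !subrr normr0.
- move=> w cw Dw; have [r r0 rD] := sq _ Dw.
  have [u [Fu su]] : F `&` square w r !=set0.
    by apply: cw; apply/nbhs_squareP; exists r.
  apply: (max _ (sqc w r) rD); first by exists u.
  by rewrite /square /= !subrr normr0.
Qed.

Variables D F : set (R * R).
Hypothesis FD : region D F.

(** The trace of [F] on such a set [C] is both open and closed in [C]. *)
Lemma region_fill C : connected C -> (forall z, C z -> closure F z -> ~ D z) ->
  C `&` F !=set0 -> C `<=` F.
Proof.
move=> cC clC ne; suff <- : C `&` F = C by move=> z [].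
apply: cC => //; first by exists F => //; exact: region_open FD.
exists (closure F); first exact: closed_closure.
apply/seteqP; split=> z [Cz Fz]; split=> //; first exact: subset_closure.
by apply: (region_closure FD) => //; exact: clC.
Qed.

Lemma half_plane_unbounded p q z : p != q -> left_of p q z ->
  left_of p q `<=` F -> bounded_set F -> False.
Proof.
move=> pq pz lF [M [_ bnd]].
have {}bnd w : F w -> `|w.1| <= M + 1 /\ `|w.2| <= M + 1.
  move=> Fw; have : `|w| <= M + 1 by apply: (bnd (M + 1)) => //; rewrite ltrDl.
  by rewrite prod_normE ge_max => /andP[].
have {bnd} bnd e : 0 <= e -> `|z.1 - e * (q.2 - p.2)| <= M + 1 /\ `|z.2 + e * (q.1 - p.1)| <= M + 1.
  move=> e0; apply: (bnd (shift_left p q e z)); apply: lF.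
  rewrite /left_of /= cross_shift ltr_wpDr // mulr_ge0 // ltW //; exact: len2_gt0.
have [] := bnd 0 (lexx _); rewrite !mul0r subr0 addr0 => b1 b2.
have M0 : 0 <= M + 1 by apply: le_trans b1.
pose K := 2 * (M + 1) + 1.
have K0 : 0 <= K by rewrite addr_ge0 // mulr_ge0.
have big d e : `|e * d| <= 2 * (M + 1) -> e = K / `|d| -> d = 0.
  move=> le eE; apply/eqP/negP => d0; move: le; rewrite eE.
  rewrite normrM (ger0_norm (_ : 0 <= K / `|d|)) ?divr_ge0 // divfK ?normr_eq0; last exact/negP.
  by rewrite /K; lra.
have tri (x y : R) : `|x| <= M + 1 -> `|y| <= M + 1 -> `|x - y| <= 2 * (M + 1).
  by move=> xM yM; apply: le_trans (ler_normB _ _) _; lra.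
have q2 : q.2 - p.2 = 0.
  apply: big (erefl _).
  have [b3 _] := bnd (K / `|q.2 - p.2|) (divr_ge0 K0 (normr_ge0 _)).
  by have := tri _ _ b1 b3; rewrite opprB addrCA subrr addr0.
have q1 : q.1 - p.1 = 0.
  apply: big (erefl _).
  have [_ b3] := bnd (K / `|q.1 - p.1|) (divr_ge0 K0 (normr_ge0 _)).
  by have := tri _ _ b3 b2; rewrite [z.2 + _]addrC addrK.
have := len2_gt0 pq; rewrite /len2 q1 q2; lra.
Qed.

(** A point of [F] strictly on the other side would put that whole open half plane,
    which is unbounded, in [F]; a point on the line is excluded as [F] is open. *)
Lemma region_left p q : p != q -> bounded_set F ->
  (forall z, closure F z -> D z -> 0 <= cross p q z) -> F `<=` left_of p q.
Proof.
move=> pq bF fr.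
have ge z : F z -> 0 <= cross p q z.
  move=> Fz; rewrite leNgt; apply/negP => lt0.
  have qpz : left_of q p z by rewrite /left_of /= cross_rev oppr_gt0.
  apply: (@half_plane_unbounded q p z) => //; first by rewrite eq_sym.
  apply: region_fill; first by apply: convex_set2_connected; exact: convex_left.
    move=> w; rewrite /left_of /= cross_rev oppr_gt0 => w0 cw Dw.
    by have := fr _ cw Dw; rewrite leNgt w0.
  by exists z.
move=> z Fz; have /nbhs_squareP[r r0 rF] : nbhs z F.
  by apply: open_nbhs_nbhs; split => //; exact: region_open FD.
have [e e0 [_ /rF /ge]] := shift_square p q z r0.
rewrite cross_shift mulNr subr_ge0 /left_of /=; apply: lt_le_trans.
by rewrite mulr_gt0 // len2_gt0.
Qed.

Definition open_triangle a b c : set (R * R) := left_of a b `&` left_of b c `&` left_of c a.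

(** When a, b, c are collinear, [region_left] applied to both directions of the line
    leaves no room for [F]. Otherwise it puts [F] inside the open triangle, and
    [region_fill] makes it the whole of it. *)
Lemma region_triangle a b c : a != b -> bounded_set F -> F !=set0 ->
  (forall z, closure F z -> D z ->
     [\/ segment a b z, segment b c z | segment c a z]) ->
  0 <= cross a b c -> 0 < cross a b c /\ F = open_triangle a b c.
Proof.
move=> ab bF [z0 Fz0] fr abc0.
have on p q x y z : segment x y z -> 0 <= cross p q x -> 0 <= cross p q y -> 0 <= cross p q z.
  move=> [t + <-] x0 y0; rewrite /= in_itv /= => /andP[t0 t1].
  by rewrite -[(_, _)]/(mix t x y) crossD addr_ge0 // mulr_ge0 // subr_ge0.
have caa x y : cross x y x = 0 by rewrite /cross; ring.
have cab x y : cross x y y = 0 by rewrite /cross; ring.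
have lt : 0 < cross a b c.
  rewrite lt_neqAle abc0 andbT eq_sym; apply/eqP => abc.
  have F1 : F `<=` left_of a b.
    by apply: region_left => // z cz Dz; case: (fr z cz Dz) => s; apply: (on _ _ _ _ _ s); rewrite ?caa ?cab ?abc.
  have F2 : F `<=` left_of b a.
    apply: region_left => //; first by rewrite eq_sym.
    by move=> z cz Dz; case: (fr z cz Dz) => s; apply: (on _ _ _ _ _ s); rewrite ?caa ?cab // cross_rev abc oppr0.
  have := F1 _ Fz0; have := F2 _ Fz0; rewrite /left_of /= cross_rev oppr_gt0 => lt0.
  by rewrite ltNge ltW.
have bca : 0 < cross b c a by rewrite cross_rot.
have cab' : 0 < cross c a b by rewrite cross_rot.
have bc : b != c by apply: contraTneq lt => ->; rewrite cab ltxx.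
have ca : c != a by apply: contraTneq lt => ->; rewrite caa ltxx.
have side p q : p != q -> 0 <= cross p q a -> 0 <= cross p q b -> 0 <= cross p q c ->
    F `<=` left_of p q.
  move=> pq pa pb pc; apply: region_left => // z cz Dz.
  by case: (fr z cz Dz) => s; exact: (on _ _ _ _ _ s).
have Fsub : F `<=` open_triangle a b c.
  move=> z Fz; split; first split.
  - by apply: (side a b) => //; rewrite ?caa ?cab.
  - by apply: (side b c) => //; rewrite ?caa ?cab // ltW.
  - by apply: (side c a) => //; rewrite ?caa ?cab // ltW.
split => //; apply/seteqP; split => //; apply: region_fill.
- by apply: convex_set2_connected; do 2?apply: convexI; exact: convex_left.
- move=> z [[zab zbc] zca] cz Dz.
  by case: (fr z cz Dz) => -[t _ e]; [move: zab|move: zbc|move: zca];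
    rewrite -e /left_of /= -[(_, _)]/(mix t _ _) cross_mix_side ltxx.
- by exists z0; split => //; exact: Fsub.
Qed.

Lemma square_nbhs z r w : square z r w -> nbhs w (square z r).
Proof.
case=> w1 w2; apply/nbhs_squareP.
exists (Num.min (r - `|z.1 - w.1|) (r - `|z.2 - w.2|)).
  by rewrite lt_min !subr_gt0 w1 w2.
move=> u [] /=; rewrite !lt_min => /andP[u1 _] /andP[_ u2]; split.
  have -> : z.1 - u.1 = (z.1 - w.1) + (w.1 - u.1) by ring.
  by apply: le_lt_trans (ler_normD _ _) _; move: u1; rewrite ltrBrDl.
have -> : z.2 - u.2 = (z.2 - w.2) + (w.2 - u.2) by ring.
by apply: le_lt_trans (ler_normD _ _) _; move: u2; rewrite ltrBrDl.
Qed.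

(** Near a point where [D] is contained in a line, [F] contains each of the two sides
    of the line that it meets. *)
Lemma half_square_closure p q m r u m' : p != q ->
  (forall w, square m r w -> D w -> cross p q w = 0) ->
  F u -> square m r u -> left_of p q u ->
  square m r m' -> cross p q m' = 0 -> closure F m'.
Proof.
move=> pq loc Fu mu lu mm' m'0 N Nm'.
have HF : square m r `&` left_of p q `<=` F.
  apply: region_max FD _ _ _ _.
  - by apply: convex_set2_connected; apply: convexI; [exact: convex_square|exact: convex_left].
  - by move=> w [mw lw] Dw; move: lw; rewrite /left_of /= loc // ltxx.
  - by exists u.
have /nbhs_squareP[e e0 eN] : nbhs m' (N `&` square m r).
  by apply: filterI => //; exact: square_nbhs.
have [d d0 [/eN[Nd sd] _]] := shift_square p q m' e0.
exists (shift_left p q d m'); split => //; apply: HF; split => //.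
by rewrite /left_of /= cross_shift m'0 add0r mulr_gt0 // len2_gt0.
Qed.

(** By [half_square_closure], the parameters [s] for which the point lies in the
    closure of [F] form an open subset of ]t1, t2[; it is also closed, so it is the
    whole interval. *)
Lemma frontier_spread p q t1 t2 t : p != q -> t1 < t < t2 ->
  (forall s, t1 < s < t2 -> exists2 r, 0 < r &
     forall w, square (mix s p q) r w -> D w -> cross p q w = 0) ->
  closure F (mix t p q) -> forall s, t1 <= s <= t2 -> closure F (mix s p q).
Proof.
move=> pq tt loc ct.
pose S := [set s | closure F (mix s p q)].
have Scl : closed S.
  by apply: preimage_closed; [move=> s _; exact: mix_continuous|exact: closed_closure].
have Sop s : t1 < s < t2 -> S s -> nbhs s S.
  move=> st Ss; have [r r0 rD] := loc _ st.
  have sqn : nbhs (mix s p q) (square (mix s p q) r) by apply/nbhs_squareP; exists r.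
  suff sub m' : square (mix s p q) r m' -> cross p q m' = 0 -> closure F m'.
    have ns : nbhs s ((fun t => mix t p q) @^-1` square (mix s p q) r).
      exact: mix_continuous sqn.
    by apply: filterS ns => s' ss'; apply: (sub _ ss'); exact: cross_mix_side.
  have [w [Fw sw]] := Ss _ sqn.
  case: (ltgtP (cross p q w) 0) => w0 sm' m'0.
  - apply: (@half_square_closure q p (mix s p q) r w) => //; first by rewrite eq_sym.
    + by move=> v sv Dv; rewrite cross_rev rD // oppr0.
    + by rewrite /left_of /= cross_rev oppr_gt0.
    + by rewrite cross_rev m'0 oppr0.
  - exact: (@half_square_closure p q (mix s p q) r w).
  - have /nbhs_squareP[r' r'0 r'F] : nbhs w (F `&` square (mix s p q) r).
      apply: filterI; last exact: square_nbhs.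
      by apply: open_nbhs_nbhs; split => //; exact: region_open FD.
    have [e e0 [/r'F[Fe se] _]] := shift_square p q w r'0.
    apply: (@half_square_closure p q (mix s p q) r (shift_left p q e w)) => //.
    by rewrite /left_of /= cross_shift w0 add0r mulr_gt0 // len2_gt0.
have SI : `]t1, t2[ `&` S = `]t1, t2[%classic.
  have cI : connected `]t1, t2[%classic.
    by apply/connected_intervalP; exact: interval_is_interval.
  apply: cI.
  - by exists t; split => //; rewrite /= in_itv.
  - exists (interior S); first exact: open_interior.
    apply/seteqP; split=> s [sI Ss]; split => //; last exact: interior_subset.
    by apply: Sop => //; move: sI; rewrite /= in_itv.
  - by exists S.
have sub : `]t1, t2[ `<=` S by move=> s; rewrite -SI => -[].
move=> s s12; suff : S s by [].
apply: Scl => N /nbhs_ballP[e /= e0 eN].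
have [t1t tt2] := andP tt; have [t1s st2] := andP s12.
pose d := `|t - s|; pose h := e / (e + d).
have d0 : 0 <= d by exact: normr_ge0.
have ed0 : 0 < e + d by rewrite ltr_pwDl.
have h0 : 0 < h by rewrite divr_gt0.
have h1 : h <= 1 by rewrite ler_pdivrMr // mul1r lerDl.
have lin (x y : R) : x <= s -> x < t -> s <= y -> t < y -> x < s + h * (t - s) < y.
  move=> xs xt sy ty; apply/andP; split.
    have -> : s + h * (t - s) = x + ((1 - h) * (s - x) + h * (t - x)) by ring.
    by rewrite ltrDl; apply: ltr_wpDl; [apply: mulr_ge0|apply: mulr_gt0]; rewrite ?subr_ge0 ?subr_gt0.
  have -> : s + h * (t - s) = y - ((1 - h) * (y - s) + h * (y - t)) by ring.
  by rewrite ltrBlDr ltrDl; apply: ltr_wpDl; [apply: mulr_ge0|apply: mulr_gt0]; rewrite ?subr_ge0 ?subr_gt0.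
(* a point near s, strictly inside the interval since t is *)
exists (s + h * (t - s)); split; first by apply: sub; rewrite /= in_itv /= lin.
apply: eN; rewrite /ball /= opprD addNKr normrN normrM (gtr0_norm h0) -/d.
by rewrite /h mulrAC ltr_pdivrMr // ltr_pM2l // ltr_pwDl.
Qed.

End Region.

(** * Triangular faces of matchstick graphs *)

Lemma nbhs_forall (T : topologicalType) (I : finType) (f : I -> set T) (z : T) :
  (forall i, nbhs z (f i)) -> nbhs z [set w | forall i, f i w].
Proof. by move=> fz; apply: (@filter_forall T I f (nbhs z) _ fz). Qed.

Section Faces.
Variables (R : realType) (G : plane_graph R).
Hypothesis hG : matchstick G.
Implicit Types (u v x y a b c : vertex G) (z w : R * R).
Local Notation D := (drawing G).
Local Notation P := (@pos R G).

Lemma edge_arcE u v : adj u v -> edge_arc u v = segment (P u) (P v).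
Proof. by move=> /hG []. Qed.

Lemma off_edge x y z : adj x y -> ~ edge_arc x y z -> nbhs z (~` edge_arc x y).
Proof.
move=> xy nz; apply: open_nbhs_nbhs; split => //.
by apply: closed_openC; rewrite edge_arcE //; exact: segment_closed.
Qed.

Lemma off_vertex x z : z <> P x -> nbhs z [set w | w <> P x].
Proof.
move=> nz; have nseg : ~ segment (P x) (P x) z.
  move=> [t _]; rewrite -[(_, _)]/(mix t _ _) => e; apply: nz.
  by rewrite -e [RHS]surjective_pairing /mix; congr pair; ring.
have : nbhs z (~` segment (P x) (P x)).
  by apply: open_nbhs_nbhs; split => //; apply: closed_openC; exact: segment_closed.
apply: filterS => w nw e; apply: nw; rewrite e; exists 0; last exact: mix0.
by rewrite /= in_itv /= lexx ler01.
Qed.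

Lemma drawing_closed : closed D.
Proof.
rewrite -[D]setCK; apply: open_closedC; rewrite openE => z nDz.
have nv : nbhs z [set w | forall x, w <> P x].
  apply: (@nbhs_forall _ _ (fun x => [set w | w <> P x])) => x.
  apply: off_vertex => e; apply: nDz; left.
  by exists x.
have ne : nbhs z [set w | forall xy : vertex G * vertex G, adj xy.1 xy.2 -> ~ edge_arc xy.1 xy.2 w].
  apply: (@nbhs_forall _ _ (fun xy => [set w | adj xy.1 xy.2 -> ~ edge_arc xy.1 xy.2 w])).
  move=> [x y] /=; have [xy|nxy] := boolP (adj x y).
    have nxyz : ~ edge_arc x y z by move=> exy; apply: nDz; right; exists x, y.
    by apply: filterS (off_edge xy nxyz) => w nw _.
  by apply: filterE.
apply: filterS2 nv ne => w nv ne [[x _ e]|[x [y [xy e]]]]; first by apply: (nv x).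
exact: (ne (x, y)).
Qed.

(** The other edges meet this one at vertices only, and being closed they avoid a
    neighbourhood of [z]; so do the vertices, isolated ones on the edge included. *)
Lemma drawing_near_edge u v z : adj u v -> edge_arc u v z -> (forall x, z <> P x) ->
  nbhs z [set w | D w -> edge_arc u v w].
Proof.
move=> uv euv nx.
have nv : nbhs z [set w | forall x, w <> P x].
  by apply: (@nbhs_forall _ _ (fun x => [set w | w <> P x])) => x; exact: off_vertex.
have ne : nbhs z [set w | forall xy : vertex G * vertex G,
    [set u; v]%SET != [set xy.1; xy.2]%SET -> adj xy.1 xy.2 -> ~ edge_arc xy.1 xy.2 w].
  apply: (@nbhs_forall _ _ (fun xy => [set w | [set u; v]%SET != [set xy.1; xy.2]%SET ->
    adj xy.1 xy.2 -> ~ edge_arc xy.1 xy.2 w])).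
  move=> [x y] /=; have [xy|nxy] := boolP (adj x y); last exact: filterE.
  have [e|ne] := eqVneq [set u; v]%SET [set x; y]%SET; first exact: filterE.
  have nxyz : ~ edge_arc x y z.
    by move=> exy; have [w [_ _ /nx]] := edge_arcs_meet uv xy ne euv exy.
  by apply: filterS (off_edge xy nxyz) => w nw _ _.
apply: filterS2 nv ne => w nv ne [[x _ e]|[x [y [xy e]]]].
  by have /esym := e; move/nv.
have [euv'|neq] := eqVneq [set u; v]%SET [set x; y]%SET; last first.
  by have := ne (x, y) neq xy.
have : x \in [set u; v]%SET by rewrite euv' !inE eqxx.
have : y \in [set u; v]%SET by rewrite euv' !inE eqxx orbT.
have nxy : x != y by apply: contraTneq xy => ->; rewrite adj_irrefl.
rewrite !inE => /orP[]/eqP ye /orP[]/eqP xe; subst x y => //.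
- by rewrite eqxx in nxy.
- by rewrite edge_arc_sym.
- by rewrite eqxx in nxy.
Qed.

Lemma pos_neq u v : u != v -> P u != P v.
Proof. by apply: contra => /eqP /(@pos_inj R G) ->. Qed.

Lemma drawing_vertex x : D (P x).
Proof. by left; exists x. Qed.

Variable F : set (R * R).
Hypothesis FD : region D F.

Lemma boundary_verticesP x : reflect (closure F (P x)) (x \in boundary_vertices G F).
Proof.
rewrite inE; apply: (iffP idP); first by rewrite inE => -[].
move=> cl; rewrite inE; split => //; move/interior_subset.
by move/(region_off FD); apply; exact: drawing_vertex.
Qed.

(** Let [x] and [y] be the vertices next to [z] on the edge on either side; they may be
    isolated vertices lying on the edge. No vertex lies strictly between them, so
    [frontier_spread] carries the frontier from [z] to both. *)
Lemma frontier_edge u v z : adj u v -> edge_arc u v z -> (forall x, z <> P x) ->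
  closure F z -> exists x y, [/\ x != y, x \in boundary_vertices G F,
    y \in boundary_vertices G F, segment (P x) (P y) z &
    edge_arc u v (P x) /\ edge_arc u v (P y)].
Proof.
move=> uv + nx cz; rewrite {1}edge_arcE // => -[t]; rewrite /= in_itv /= => t01.
rewrite -[(_, _)]/(mix t (P u) (P v)) => zE.
have nuv : u != v by apply: contraTneq uv => ->; rewrite adj_irrefl.
have puv := pos_neq nuv.
(* the parameter on the edge of a point of its line *)
pose par x := (((P x).1 - (P u).1) * ((P v).1 - (P u).1) +
  ((P x).2 - (P u).2) * ((P v).2 - (P u).2)) / len2 (P u) (P v).
have l0 : len2 (P u) (P v) != 0 by rewrite gt_eqF // len2_gt0.
have parE x s : P x = mix s (P u) (P v) -> par x = s.
  by rewrite /par => ->; move: l0; rewrite /len2 /mix /= => l0; field.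
have paru : par u = 0 by apply: parE; rewrite mix0.
have parv : par v = 1 by apply: parE; rewrite mix1.
have t0 : 0 < t.
  rewrite lt_neqAle (andP t01).1 andbT eq_sym; apply/eqP => e.
  by apply: (nx u); rewrite -zE e mix0.
have t1 : t < 1.
  rewrite lt_neqAle (andP t01).2 andbT; apply/eqP => e.
  by apply: (nx v); rewrite -zE e mix1.
pose on x := P x == mix (par x) (P u) (P v).
have onu : on u && (0 <= par u < t) by rewrite /on paru mix0 eqxx lexx.
have onv : on v && (t < par v <= 1) by rewrite /on parv mix1 eqxx lexx t1.
case: (@arg_maxP _ _ _ u (fun x => on x && (0 <= par x < t)) par onu)
  => x /andP[/eqP onx /andP[x0 xt]] xmax.
case: (@arg_minP _ _ _ v (fun x => on x && (t < par x <= 1)) par onv)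
  => y /andP[/eqP ony /andP[ty y1]] ymin.
have free (s : R) : par x < s < par y -> forall w : vertex G, mix s (P u) (P v) <> P w.
  move=> /andP[xs sy] w e; have ws := parE w s (esym e).
  have onw : on w by rewrite /on ws e.
  case: (ltgtP s t) => st.
  - by have := xmax w; rewrite onw ws st (le_trans x0 (ltW xs)) => /(_ isT) /=; rewrite leNgt xs.
  - have := ymin w; rewrite onw ws st (le_trans (ltW sy) y1) => /(_ isT).
    by rewrite leNgt sy.
  - by apply: (nx w); rewrite -e -zE st.
have on_uv (s : R) : 0 <= s <= 1 -> edge_arc u v (mix s (P u) (P v)).
  by move=> s01; rewrite edge_arcE //; exists s => //; rewrite /= in_itv.
have cl (s : R) : par x <= s <= par y -> closure F (mix s (P u) (P v)).
  apply: (@frontier_spread R D F FD _ _ _ _ t) => //; [by rewrite xt| |by rewrite zE].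
  move=> s' s'xy; have [xs' s'y] := andP s'xy.
  have s'01 : 0 <= s' <= 1.
    by rewrite (le_trans x0 (ltW xs')) (le_trans (ltW s'y) y1).
  have /nbhs_squareP[r r0 rE] := drawing_near_edge uv (on_uv _ s'01) (free _ s'xy).
  exists r => // w /rE wE /wE; rewrite edge_arcE // => -[r' _ <-].
  exact: cross_mix_side.
have xy : par x <= par y by rewrite ltW // (lt_trans xt ty).
exists x, y; split.
- by apply: contraTneq (lt_trans xt ty) => ->; rewrite ltxx.
- by apply/boundary_verticesP; rewrite onx; apply: cl; rewrite lexx.
- by apply/boundary_verticesP; rewrite ony; apply: cl; rewrite lexx xy.
- exists ((t - par x) / (par y - par x)).
    rewrite /= in_itv /=; apply/andP; split.
      by rewrite divr_ge0 // subr_ge0 // ltW.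
    by rewrite ler_pdivrMr ?subr_gt0 ?(lt_trans xt) // mul1r lerB // ltW.
  have n0 : par y - par x != 0 by rewrite subr_eq0 gt_eqF // (lt_trans xt).
  rewrite -[(_, _)]/(mix _ (P x) (P y)) -zE onx ony; move: (par x) (par y) n0 => a b n0.
  by rewrite /mix /=; congr pair; field.
- have y0 : 0 <= par y := le_trans x0 xy.
  have x1 : par x <= 1 := le_trans xy y1.
  by split; [rewrite onx; apply: on_uv; rewrite x0|rewrite ony; apply: on_uv; rewrite y0].
Qed.

Lemma segmentC (a b : R * R) : segment a b = segment b a.
Proof.
suff sub (x y : R * R) : segment x y `<=` segment y x by apply/seteqP; split; exact: sub.
move=> z [t t01 <-]; exists (1 - t); last by congr pair; ring.
by move: t01; rewrite /= !in_itv /= subr_ge0 gerBl andbC.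
Qed.

Lemma segment_l (a b : R * R) : segment a b a.
Proof. by exists 0; [rewrite /= in_itv /= lexx ler01|exact: mix0]. Qed.

Hypothesis bF : bounded_set F.
Hypothesis F0 : F !=set0.

Lemma face_open_triangle a b c : boundary_vertices G F = [set a; b; c]%SET -> a != b ->
  0 <= cross (P a) (P b) (P c) ->
  0 < cross (P a) (P b) (P c) /\ F = open_triangle (P a) (P b) (P c).
Proof.
move=> bvE ab abc; apply: region_triangle FD _ _ _ _ bF F0 _ abc; first exact: pos_neq.
move=> z cz Dz.
have [[x zx]|nx] := pselect (exists x, z = P x).
  have : x \in boundary_vertices G F by apply/boundary_verticesP; rewrite -zx.
  rewrite bvE zx !inE -orbA => /or3P[]/eqP->; [constructor 1|constructor 2|constructor 3]; exact: segment_l.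
have {}nx x : z <> P x by move=> e; apply: nx; exists x.
case: Dz => [[x _ /esym /nx //]|[u [v [uv euv]]]].
have [x [y [xy xb yb sxy _]]] := frontier_edge uv euv nx cz.
move: xb yb xy sxy; rewrite bvE !inE -!orbA => /or3P[]/eqP-> /or3P[]/eqP-> xy sxy;
  rewrite ?eqxx // in xy; try (by constructor 1); try (by constructor 2);
  try (by constructor 3); rewrite segmentC in sxy; try (by constructor 1);
  try (by constructor 2); by constructor 3.
Qed.

(** The midpoint of ab lies in the closure of the open triangle but not in the
    triangle, hence on the drawing. It is not a vertex, so it is on an edge, and the
    boundary vertices next to it on this edge, given by [frontier_edge], can only be
    [a] and [b]. *)
Lemma face_side a b c : boundary_vertices G F = [set a; b; c]%SET ->
  0 < cross (P a) (P b) (P c) -> F = open_triangle (P a) (P b) (P c) ->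
  exists u v, [/\ adj u v, edge_arc u v (P a) & edge_arc u v (P b)].
Proof.
move=> bvE abc FE; set m := mix (1 / 2) (P a) (P b).
have caa (x y : R * R) : cross x y x = 0 :> R by rewrite /cross; ring.
have cab (x y : R * R) : cross x y y = 0 :> R by rewrite /cross; ring.
have h0 : 0 < 1 / 2 :> R by lra.
have h0' : 0 < 1 - 1 / 2 :> R by lra.
have mab : cross (P a) (P b) m = 0 by exact: cross_mix_side.
have mbc : 0 < cross (P b) (P c) m.
  by rewrite crossD caa mulr0 addr0 mulr_gt0 // cross_rot.
have mca : 0 < cross (P c) (P a) m.
  by rewrite crossD cab mulr0 add0r mulr_gt0 // cross_rot cross_rot.
have cm : closure F m.
  move=> N Nm; have : nbhs (0 : R) ((fun t => mix t m (P c)) @^-1` N).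
    by apply: mix_continuous; rewrite mix0.
  move=> /nbhs_ballP[e e0 eN]; pose d := Num.min (e / 2) (1 / 2).
  have d0 : 0 < d by rewrite lt_min divr_gt0.
  have d1 : 0 < 1 - d by rewrite subr_gt0 gt_min; apply/orP; right; lra.
  (* a point of the triangle near m, on the segment from m to the vertex c *)
  exists (mix d m (P c)); split; last first.
    apply: eN; rewrite /ball /= sub0r normrN gtr0_norm // gt_min; apply/orP; left.
    by rewrite ltr_pdivrMr // ltr_pMr // ltr1n.
  rewrite FE; split; first split; rewrite /left_of /= crossD.
  - by rewrite mab mulr0 add0r mulr_gt0.
  - by rewrite cab mulr0 addr0 mulr_gt0.
  - by rewrite caa mulr0 addr0 mulr_gt0.
have Dm : D m.
  apply: contrapT => nD; have := region_closure FD cm nD.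
  by rewrite FE => -[[]]; rewrite /left_of /= mab ltxx.
have nx x : m <> P x.
  move=> e; have : x \in boundary_vertices G F by apply/boundary_verticesP; rewrite -e.
  rewrite bvE !inE -orbA => /or3P[]/eqP xe; move: mbc mca; rewrite e xe.
  - by rewrite cab ltxx.
  - by rewrite caa ltxx.
  - by rewrite cab ltxx.
case: Dm => [[x _ /esym /nx //]|[u [v [uv euv]]]].
have [x [y [xy xb yb sxy [ex ey]]]] := frontier_edge uv euv nx cm.
have off (p q : R * R) : segment p q m -> 0 < cross p q m -> False.
  by move=> [t _ <-]; rewrite -[(_, _)]/(mix t p q) cross_mix_side ltxx.
have nca : ~ segment (P c) (P a) m by move=> s; exact: off s mca.
have nbc : ~ segment (P b) (P c) m by move=> s; exact: off s mbc.
exists u, v; move: xb yb xy sxy ex ey.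
rewrite bvE !inE -!orbA => /or3P[]/eqP-> /or3P[]/eqP-> xy sxy ex ey; rewrite ?eqxx // in xy => {xy};
  by [|case: nca|case: nbc|case: nca; rewrite segmentC|case: nbc; rewrite segmentC].
Qed.

(** By [face_side] each side of the triangle lies on an edge, a priori a longer one.
    The edges carrying two different sides are different as a, b, c are not
    collinear, and both contain the common vertex of these sides, which must
    therefore be an endpoint of both. *)
Lemma side_adj a b c : boundary_vertices G F = [set a; b; c]%SET ->
  0 < cross (P a) (P b) (P c) -> F = open_triangle (P a) (P b) (P c) -> adj a b.
Proof.
move=> bvE abc FE.
have cross_off u v : adj u v -> edge_arc u v (P a) -> edge_arc u v (P b) ->
    edge_arc u v (P c) -> False.
  move=> uv; rewrite edge_arcE // => -[ta _ ea] [tb _ eb] [tc _ ec].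
  move: abc; rewrite -ea -eb -ec (_ : cross _ _ _ = 0) ?ltxx //.
  by rewrite /cross /=; ring.
have [u [v [uv uva uvb]]] := face_side bvE abc FE.
have bca : 0 < cross (P b) (P c) (P a) by rewrite cross_rot.
have cab : 0 < cross (P c) (P a) (P b) by rewrite cross_rot.
have bvE1 : boundary_vertices G F = [set b; c; a]%SET.
  by rewrite bvE; apply/setP => x; rewrite !inE -!orbA orbC -orbA.
have bvE2 : boundary_vertices G F = [set c; a; b]%SET.
  by rewrite bvE1; apply/setP => x; rewrite !inE -!orbA orbC -orbA.
have FE1 : F = open_triangle (P b) (P c) (P a).
  by rewrite FE /open_triangle -setIA setIC.
have FE2 : F = open_triangle (P c) (P a) (P b).
  by rewrite FE1 /open_triangle -setIA setIC.
have [u1 [v1 [uv1 uv1b uv1c]]] := face_side bvE1 bca FE1.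
have [u2 [v2 [uv2 uv2c uv2a]]] := face_side bvE2 cab FE2.
have arcE x y x' y' : adj x y -> adj x' y' -> [set x; y]%SET = [set x'; y']%SET ->
    edge_arc x y = edge_arc x' y'.
  move=> xy xy' e.
  have : x \in [set x'; y']%SET by rewrite -e !inE eqxx.
  have : y \in [set x'; y']%SET by rewrite -e !inE eqxx orbT.
  have nxy : x != y by apply: contraTneq xy => ->; rewrite adj_irrefl.
  rewrite !inE => /orP[]/eqP ye /orP[]/eqP xe; move: nxy; rewrite xe ye ?eqxx // => _.
  by rewrite edge_arc_sym // adj_sym.
have end_of x u' v' : adj u' v' -> edge_arc u v (P x) -> edge_arc u' v' (P x) ->
    [set u; v]%SET != [set u'; v']%SET -> x \in [set u; v]%SET.
  move=> uv' ex ex' ne; have [w [wuv _ e]] := edge_arcs_meet uv uv' ne ex ex'.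
  by rewrite (pos_inj e).
have bu : b \in [set u; v]%SET.
  apply: (end_of b u1 v1) => //; apply/eqP => e; apply: (cross_off u v) => //.
  by rewrite (arcE _ _ _ _ uv uv1 e).
have au : a \in [set u; v]%SET.
  apply: (end_of a u2 v2) => //; apply/eqP => e; apply: (cross_off u v) => //.
  by rewrite (arcE _ _ _ _ uv uv2 e).
have nab : a != b.
  by apply: contraTneq abc => ->; rewrite /cross subrr subrr !mul0r subrr ltxx.
move: au bu nab; rewrite !inE => /orP[]/eqP-> /orP[]/eqP->; rewrite ?eqxx // => _.
by rewrite adj_sym.
Qed.

End Faces.

Lemma cards3_set (T : finType) (S : {set T}) : #|S| = 3%N ->
  exists a b c, [/\ a != b, b != c, a != c & S = [set a; b; c]%SET].
Proof.
move=> S3; have /card_gt0P[a aS] : (0 < #|S|)%N by rewrite S3.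
have /cards2P[b [c [bc Sbc]]] : #|S :\ a| == 2.
  by move: S3; rewrite (cardsD1 a) aS add1n => -[->].
have bS : b \in S :\ a by rewrite Sbc !inE eqxx.
have cS : c \in S :\ a by rewrite Sbc !inE eqxx orbT.
move: bS cS; rewrite !inE => /andP[ba bS] /andP[ca cS].
exists a, b, c; split; rewrite // 1?eq_sym //.
by rewrite -(finset.setD1K aS) Sbc finset.setUA.
Qed.

Section Count.
Variables (R : realType) (G : plane_graph R).
Hypothesis hG : matchstick G.
Local Notation P := (@pos R G).
Local Notation T := (triangles (@adj R G)).

(** The boundary vertices determine the face, since it is the interior of their
    triangle. *)
Lemma triangular_faceP F : bounded_triangular_faces G F ->
  (exists a b c, boundary_vertices G F = [set a; b; c]%SET /\
     [/\ adj a b, adj b c & adj c a]) /\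
   forall F', bounded_triangular_faces G F' ->
     boundary_vertices G F' = boundary_vertices G F -> F' = F.
Proof.
have reg F' : faces G F' -> region (drawing G) F' /\ F' !=set0.
  move=> [z nz <-]; split.
    by apply: component_region => //; exact: drawing_closed.
  by exists z; exact: connected_component_refl.
move=> [fF bF b3]; have [FD F0] := reg _ fF.
have [a [b [c [ab bc ac bvE abc]]]] : exists a b c, [/\ a != b, b != c, a != c,
    boundary_vertices G F = [set a; b; c]%SET & 0 <= cross (P a) (P b) (P c)].
  have [a [b [c [ab bc ac bvE]]]] := cards3_set b3.
  have [abc|/ltW abc] := leP 0 (cross (P a) (P b) (P c)).
    by exists a, b, c.
  exists a, c, b; split; rewrite // 1?eq_sym //.
    by rewrite bvE; apply/setP => x; rewrite !inE -!orbA; congr (_ || _); rewrite orbC.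
  by rewrite cross_rev cross_rot cross_rot oppr_ge0.
have [abc' FE] := face_open_triangle hG FD bF F0 bvE ab abc.
split; last first.
  move=> F' [fF' bF' b3'] bvE'; have [FD' F0'] := reg _ fF'.
  rewrite bvE in bvE'.
  by have [_ ->] := face_open_triangle hG FD' bF' F0' bvE' ab abc.
exists a, b, c; split => //; split.
- exact: (side_adj hG FD bvE abc' FE).
- have bca : 0 < cross (P b) (P c) (P a) by rewrite cross_rot.
  apply: (side_adj hG FD _ bca).
    by rewrite bvE; apply/setP => x; rewrite !inE -!orbA orbC -orbA.
  by rewrite FE /open_triangle -setIA setIC.
- have cab : 0 < cross (P c) (P a) (P b) by rewrite cross_rot cross_rot.
  apply: (side_adj hG FD _ cab).
    by rewrite bvE; apply/setP => x; rewrite !inE; case: (x == a); case: (x == b); case: (x == c).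
  by rewrite FE /open_triangle setIC setIA.
Qed.

Lemma triangular_faces_le : finite_set (bounded_triangular_faces G) /\
  (#|` fset_set (bounded_triangular_faces G)| <= #|T|)%N.
Proof.
pose B := bounded_triangular_faces G.
pose h (S : {set vertex G}) : set (R * R) :=
  xget set0 [set F | B F /\ boundary_vertices G F = S].
have hB F : B F -> boundary_vertices G F \in T /\ h (boundary_vertices G F) = F.
  move=> BF; have [[a [b [c [bvE [eab ebc eca]]]]] uniqF] := triangular_faceP BF.
  split.
    rewrite inE; apply/andP; split; first by case: BF => _ _ ->.
    apply/forall_inP => x; rewrite bvE => xS; apply/forall_inP => y yS; apply/implyP.
    move: xS yS; rewrite !inE -!orbA => /or3P[]/eqP-> /or3P[]/eqP->;
      by rewrite ?eqxx // => _; rewrite // adj_sym.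
  rewrite /h; case: xgetP => [F' _ [BF' e]|/(_ F) nF]; first exact: uniqF.
  by case: nF.
have sub : B `<=` h @` [set` T].
  by move=> F /hB[bT hF]; exists (boundary_vertices G F).
have fT : finite_set [set` T] by exact: finite_finset.
have fB : finite_set B by apply: sub_finite_set sub _; exact: finite_image.
split => //; rewrite cardE -(size_map h); apply: uniq_leq_size; first exact: fset_uniq.
move=> F; rewrite in_fset_set // inE => /hB[bT hF].
by rewrite -hF map_f // mem_enum.
Qed.

End Count.

(** * Rotation to general position *)

(** Projecting to the direction (1, k) separates points u, v as soon as k exceeds the
    absolute value of the quotient of their coordinate differences. Division by
    zero, whose value is 0, does no harm: then the abscissas differ. *)
Lemma generic_direction (R : rcfType) (V : finType) (P : V -> R * R) : injective P ->
  exists c s : R, c ^+ 2 + s ^+ 2 = 1 /\ injective (fun v => c * (P v).1 + s * (P v).2).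
Proof.
move=> injP; pose q u v := `|((P u).1 - (P v).1) / ((P u).2 - (P v).2)|.
pose k := 1 + \sum_(uv : V * V) q uv.1 uv.2.
have q0 u v : 0 <= q u v by exact: normr_ge0.
have qk u v : q u v < k.
  by rewrite /k (bigD1 (u, v)) //= addrCA ltrDl ltr_pwDl // sumr_ge0.
have k0 : 0 < k by rewrite /k ltr_pwDl // sumr_ge0.
pose m := Num.sqrt (1 + k ^+ 2).
have m2 : m ^+ 2 = 1 + k ^+ 2 by rewrite sqr_sqrtr // addr_ge0 // sqr_ge0.
have m0 : m != 0 by rewrite -sqrf_eq0 m2 gt_eqF // ltr_pwDl // sqr_ge0.
exists (m^-1), (k / m); split.
  by rewrite exprVn expr_div_n m2; field; rewrite -m2 sqrf_eq0.
move=> u v e; apply: injP.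
have {}e : ((P u).1 - (P v).1) + k * ((P u).2 - (P v).2) = 0.
  have -> : ((P u).1 - (P v).1) + k * ((P u).2 - (P v).2) =
     m * ((m^-1 * (P u).1 + k / m * (P u).2) - (m^-1 * (P v).1 + k / m * (P v).2)) by field.
  by rewrite e subrr mulr0.
have y0 : (P u).2 - (P v).2 = 0.
  apply/eqP; apply: contraT => y0.
  have : q u v = k.
    rewrite /q (_ : _ / _ = - k) ?normrN ?gtr0_norm //.
    apply: (mulIf y0); rewrite divfK // mulNr; apply/eqP.
    by rewrite -subr_eq0 opprK e.
  by move=> qe; have := qk u v; rewrite qe ltxx.
move: e; rewrite y0 mulr0 addr0 => x0.
by rewrite [LHS]surjective_pairing [RHS]surjective_pairing; congr pair; apply/eqP; rewrite -subr_eq0 ?x0 ?y0.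
Qed.

Lemma matchstick_straight (R : realType) (G : plane_graph R) : matchstick G ->
  exists X Y : vertex G -> R, straight X Y (@adj R G).
Proof.
move=> hG; have [c [s [cs inj]]] := generic_direction (@pos_inj R G).
exists (fun v => c * (pos v).1 + s * (pos v).2), (fun v => c * (pos v).2 - s * (pos v).1).
split => //.
- exact: adj_sym.
- exact: adj_irrefl.
- move=> u v /hG[_ d1].
  have sq : ((pos u).1 - (pos v).1) ^+ 2 + ((pos u).2 - (pos v).2) ^+ 2 = 1.
    rewrite -[RHS](expr1n R 2) -d1 /euclid_dist sqr_sqrtr //.
    by rewrite addr_ge0 // sqr_ge0.
  rewrite -[RHS]mulr1 -{1}cs -sq; ring.
- move=> u v x y a b uv xy ne a01 b01 eX eY.
  have unrot (z1 z2 z1' z2' : R) : c * z1 + s * z2 = c * z1' + s * z2' ->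
      c * z2 - s * z1 = c * z2' - s * z1' -> z1 = z1' /\ z2 = z2'.
    move=> e1 e2; split.
      rewrite -[LHS]mul1r -[RHS]mul1r -cs.
      have -> : (c ^+ 2 + s ^+ 2) * z1 = c * (c * z1 + s * z2) - s * (c * z2 - s * z1) by ring.
      by rewrite e1 e2; ring.
    rewrite -[LHS]mul1r -[RHS]mul1r -cs.
    have -> : (c ^+ 2 + s ^+ 2) * z2 = s * (c * z1 + s * z2) + c * (c * z2 - s * z1) by ring.
    by rewrite e1 e2; ring.
  have [e1 e2] : (mix a (pos u) (pos v)).1 = (mix b (pos x) (pos y)).1 /\
                 (mix a (pos u) (pos v)).2 = (mix b (pos x) (pos y)).2.
    apply: unrot; rewrite /mix /=.
      by transitivity ((1 - a) * (c * (pos u).1 + s * (pos u).2) + a * (c * (pos v).1 + s * (pos v).2));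
        [ring|rewrite eX; ring].
    by transitivity ((1 - a) * (c * (pos u).2 - s * (pos u).1) + a * (c * (pos v).2 - s * (pos v).1));
        [ring|rewrite eY; ring].
  have zu : edge_arc u v (mix a (pos u) (pos v)).
    by rewrite (hG _ _ uv).1; exists a => //; rewrite /= in_itv.
  have zx : edge_arc x y (mix a (pos u) (pos v)).
    rewrite (hG _ _ xy).1; exists b; first by rewrite /= in_itv.
    by rewrite [RHS]surjective_pairing e1 e2.
  have [w [wu wx e]] := edge_arcs_meet uv xy ne zu zx.
  exists w; split => //; rewrite -e /mix /=; ring.
Qed.

(** * The number of triangular faces *)

Theorem corollary3 (R : realType) (n : nat) (G : plane_graph R)
    (hG : matchstick G) (hcard : #|vertex G| = n) (hn : (1 <= n)%N) :
  finite_set (bounded_triangular_faces G) /\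
  (#|` fset_set (bounded_triangular_faces G)|)%:R
    <= 2 * n%:R + 1 - Num.sqrt (12 * n%:R - 3) :> R.
Proof.
have [fin le] := triangular_faces_le hG; split => //.
have [X [Y H]] := matchstick_straight hG.
have A0 : [set: vertex G]%SET != finset.set0 by rewrite -card_gt0 cardsT hcard.
have [f] := triangles_in_bound H A0.
have -> : triangles_in (@adj R G) [set: vertex G]%SET = triangles (@adj R G).
  by apply/setP => S; rewrite !inE finset.subsetT andbT.
rewrite cardsT hcard => -[fE f2].
set t := #|triangles _| in fE f2 le.
have le' : #|` fset_set (bounded_triangular_faces G)|%:R <= t%:R :> R by rewrite ler_nat.
apply: le_trans le' _; rewrite lerBrDr -lerBrDl.
have fER : t%:R + f%:R + 2 = 2 * n%:R :> R by rewrite -!natrD fE natrM.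
have -> : 2 * n%:R + 1 - t%:R = f%:R + 3 :> R by rewrite -fER; ring.
rewrite -[leRHS]ger0_norm ?addr_ge0 // -sqrtr_sqr ler_wsqrtr //.
have f2R : 6 * t%:R <= f%:R ^+ 2 :> R by rewrite -natrX -natrM ler_nat.
have -> : 12 * n%:R - 3 = 6 * t%:R + 6 * f%:R + 9 :> R.
  have -> : 12 * n%:R = 6 * (2 * n%:R) :> R by ring.
  by rewrite -fER; ring.
rewrite (_ : (f%:R + 3) ^+ 2 = f%:R ^+ 2 + 6 * f%:R + 9 :> R); last by ring.
by rewrite -!addrA lerD2r.
Qed.
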